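(* Suppose that $\varphi_z\in L^2(\mathbb R_+)$ and $\theta_z\in L^2(\mathbb R_+)$ for all $z\in\mathbb C$, and let $t\in\mathbb R\cup\{\infty\}$. Then for all $z\in\mathbb C$ with $\operatorname{Im}z\ne0$ and all $h\in L^2(\mathbb R_+)$, the resolvent $R_t(z)=(A_t-zI)^{-1}$ of the self-adjoint operator $A_t$ is given by the equality $$R_t(z)h=\gamma_t(z)\langle h,\varphi_{\bar z}\rangle\varphi_z+\mathcal R(z)h,$$ where $$\gamma_t(z)=\frac{z\langle\theta_z,\theta_0\rangle+\bigl(1+z\langle\theta_z,\varphi_0\rangle\bigr)t}{1-z\langle\varphi_z,\theta_0\rangle-z\langle\varphi_z,\varphi_0\rangle t}\qquad\text{if }t\in\mathbb R$$ and $$\gamma_\infty(z)=-\frac{1+z\langle\theta_z,\varphi_0\rangle}{z\langle\varphi_z,\varphi_0\rangle}.$$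
   Context: $\mathbb R_+=(0,\infty)$; $\langle\cdot,\cdot\rangle$ is the scalar product of the complex space $L^2(\mathbb R_+)$, linear in the first argument; $I$ is the identity operator. Let $p\in C^1(\mathbb R_+)$, $q\in C(\mathbb R_+)$ be real functions having finite limits as $x\to0$, with $p(x)>0$ for all $x\ge0$ (including the limit $p(0)>0$). Put $(\mathcal A u)(x)=-(p(x)u'(x))'+q(x)u(x)$. Fix $\alpha\in\mathbb R\cup\{\infty\}$ and consider the boundary condition (BC): $u'(0)=\alpha u(0)$ (for $\alpha=\infty$ this means $u(0)=0$), where $u(0)=u(+0)$, $u'(0)=u'(+0)$. Solutions: for $z\in\mathbb C$, $\varphi_z$ and $\theta_z$ are the solutions of $-(pu')'+qu=zu$ on $\mathbb R_+$ with $\varphi_z(0)=1$, $\varphi_z'(0)=\alpha$, $\theta_z(0)=0$, $\theta_z'(0)=-p(0)^{-1}$ if $\alpha\in\mathbb R$, and $\varphi_z(0)=0$, $\varphi_z'(0)=1$, $\theta_z(0)=p(0)^{-1}$, $\theta_z'(0)=0$ if $\alpha=\infty$. Fix a cut-off function $\omega\in C^\infty(\mathbb R_+)$ with $\omega(x)=0$ for small $x$ and $\omega(x)=1$ for large $x$, and put $\tilde\theta_z(x)=\omega(x)\theta_z(x)$. Operators: $A_{00}u=\mathcal Au$ with domain $\mathcal D(A_{00})$ consisting of $u\in C^2(\mathbb R_+)$ such that $u(x)=0$ for sufficiently large $x$, the limits $u(+0),u'(+0)$ exist, (BC) holds, and $\mathcal Au\in L^2(\mathbb R_+)$. $A_{\min}$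 is the closure of $A_{00}$ in $L^2(\mathbb R_+)$. $A_{\max}=A_{\min}^*$; it acts by $A_{\max}u=\mathcal Au$ on the set $\mathcal D(A_{\max})$ of $u$ belonging locally (on $(0,\infty)$) to the Sobolev space $\mathsf H^2$, satisfying (BC), and such that $u\in L^2(\mathbb R_+)$, $\mathcal Au\in L^2(\mathbb R_+)$. When $\varphi_z,\theta_z\in L^2(\mathbb R_+)$ for all $z$, the operators $A_t$ are the restrictions of $A_{\max}$ to the domains $\mathcal D(A_t)=\mathcal D(A_{\min})\dotplus\{t\varphi_0+\tilde\theta_0\}$ for $t\in\mathbb R$ and $\mathcal D(A_\infty)=\mathcal D(A_{\min})\dotplus\{\varphi_0\}$, where $\{h\}$ is the one-dimensional span of $h$ and $\dotplus$ is the direct sum; the $A_t$ are self-adjoint. The operator $\mathcal R(z)$, $z\in\mathbb C$, is the bounded operator in $L^2(\mathbb R_+)$ given by $(\mathcal R(z)h)(x)=\theta_z(x)\int_0^x\varphi_z(y)h(y)\,dy+\varphi_z(x)\int_x^\infty\theta_z(y)h(y)\,dy$. *)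

(* Defs.v *)
From HB Require Import structures.
From mathcomp Require Import all_boot all_order all_algebra.
From mathcomp Require Import complex.
From mathcomp Require Import all_classical all_reals all_analysis.

Set Implicit Arguments.
Unset Strict Implicit.
Unset Printing Implicit Defensive.

Import Order.TTheory GRing.Theory Num.Theory.
Import numFieldNormedType.Exports.

Local Open Scope classical_set_scope.
Local Open Scope ring_scope.
Local Open Scope complex_scope.

(* A function on R_+ = (0,+oo) is a total function on R whose values outside
   (0,+oo) are never used.  Elements of L^2(R_+) are represented by such
   functions; equality in L^2(R_+) is equality a.e. on (0,+oo). *)

Section Defs.
Context {R : realType}.
Implicit Types (p q f omega : R -> R) (u v h g : R -> R[i]) (z : R[i]).

Definition Rplus : set R := `]0, +oo[.

Notation mu := (@lebesgue_measure R).

Definition re u : R -> R := fun x => complex.Re (u x).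
Definition im u : R -> R := fun x => complex.Im (u x).

(* f \in C^n(R_+) *)
Definition Cn (n : nat) f : Prop :=
  (forall k, (k < n)%N -> forall x : R, 0 < x -> derivable (derive1n k f) x 1) /\
  (forall x : R, 0 < x -> {for x, continuous (derive1n n f)}).

Definition Cinfty f : Prop := forall n, Cn n f.

Definition cCn (n : nat) u : Prop := Cn n (re u) /\ Cn n (im u).

Definition cderiv u : R -> R[i] :=
  fun x => derive1 (re u) x +i* derive1 (im u) x.

Definition lim0 u (l : R[i]) : Prop :=
  (re u x @[x --> 0^'+] --> complex.Re l) /\
  (im u x @[x --> 0^'+] --> complex.Im l).

(* u(+0) = b.1 and u'(+0) = b.2 *)
Definition boundary_values u (b : R[i] * R[i]) : Prop :=
  lim0 u b.1 /\ lim0 (cderiv u) b.2.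

Definition cintegral (D : set R) u : R[i] :=
  (\int[mu]_(x in D) re u x) +i* (\int[mu]_(x in D) im u x).

Definition L2 u : Prop :=
  [/\ measurable_fun Rplus (re u), measurable_fun Rplus (im u) &
      (\int[mu]_(x in Rplus) (Normc.normc (u x) ^+ 2)%:E < +oo)%E].

Definition inner u v : R[i] := cintegral Rplus (fun x => u x * (v x)^*).

Definition L2norm u : R :=
  Num.sqrt (\int[mu]_(x in Rplus) (Normc.normc (u x) ^+ 2)).

(* Operators in L^2(R_+) are given by their graphs: T (u, h) means that
   u belongs to the domain of T and T u = h. *)
Definition operator := set ((R -> R[i]) * (R -> R[i])).
Implicit Type T : operator.

Definition dom T : set (R -> R[i]) := [set u | exists h, T (u, h)].

Definition op_closure T : operator :=
  [set uh | [/\ L2 uh.1, L2 uh.2 &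
    forall e : R, 0 < e -> exists vg, [/\ T vg,
      L2norm (fun x => uh.1 x - vg.1 x) < e &
      L2norm (fun x => uh.2 x - vg.2 x) < e]]].

Definition adjoint T : operator :=
  [set vg | [/\ L2 vg.1, L2 vg.2 &
    forall u h, T (u, h) -> inner h vg.1 = inner u vg.2]].

Definition restriction T (D : set (R -> R[i])) : operator :=
  [set uh | T uh /\ D uh.1].

Definition sub_scalar T z : operator :=
  [set (uh.1, fun x => uh.2 x - z * uh.1 x) | uh in T].

Definition op_inverse T : operator := [set fu | T (fu.2, fu.1)].

Definition resolvent T z : operator := op_inverse (sub_scalar T z).

Definition calA p q u : R -> R[i] := fun x =>
  - cderiv (fun y => (p y)%:C * cderiv u y) x + (q x)%:C * u x.

(* The parameter alpha ranges over R \cup {oo}; None stands for oo.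
   The same convention is used for the parameter t below. *)
Definition BC (alpha : option R) (b : R[i] * R[i]) : Prop :=
  if alpha is Some a then b.2 = a%:C * b.1 else b.1 = 0.

Definition solution p q z u : Prop :=
  cCn 2 u /\ forall x, 0 < x -> calA p q u x = z * u x.

Definition phi_init (alpha : option R) : R[i] * R[i] :=
  if alpha is Some a then (1, a%:C) else (0, 1).

(* p0 is the limit p(0) of p at 0 *)
Definition theta_init (p0 : R) (alpha : option R) : R[i] * R[i] :=
  if alpha is Some _ then (0, - (p0^-1)%:C) else ((p0^-1)%:C, 0).

Definition cutoff omega : Prop :=
  [/\ Cinfty omega, (\forall x \near 0^'+, omega x = 0) &
      (\forall x \near +oo, omega x = 1)].

Definition A00 p q alpha : operator :=
  [set uh | [/\ uh.2 = calA p q uh.1, cCn 2 uh.1,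
    (\forall x \near +oo, uh.1 x = 0),
    (exists2 b, boundary_values uh.1 b & BC alpha b) &
    L2 (calA p q uh.1)]].

Definition Amin p q alpha : operator := op_closure (A00 p q alpha).

Definition Amax p q alpha : operator := adjoint (Amin p q alpha).

Section Extensions.
Context (omega : R -> R) (phi theta : R[i] -> R -> R[i]).

(* the function spanning D(A_t) modulo D(A_min) *)
Definition extra_fun (t : option R) : R -> R[i] := fun x =>
  if t is Some s then s%:C * phi 0 x + (omega x)%:C * theta 0 x
  else phi 0 x.

Definition domAt p q alpha t : set (R -> R[i]) :=
  [set u | exists2 v, dom (Amin p q alpha) v & exists c : R[i],
    u = (fun x => v x + c * extra_fun t x) %[ae mu in Rplus]].

Definition At p q alpha t : operator :=
  restriction (Amax p q alpha) (domAt p q alpha t).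

Definition calR z h : R -> R[i] := fun x =>
  theta z x * cintegral `]0, x[ (fun y => phi z y * h y) +
  phi z x * cintegral `]x, +oo[ (fun y => theta z y * h y).

Definition gamma_den (t : option R) z : R[i] :=
  if t is Some s then
    1 - z * inner (phi z) (theta 0) - z * inner (phi z) (phi 0) * s%:C
  else z * inner (phi z) (phi 0).

Definition gamma (t : option R) z : R[i] :=
  if t is Some s then
    (z * inner (theta z) (theta 0) +
     (1 + z * inner (theta z) (phi 0)) * s%:C) / gamma_den t z
  else - ((1 + z * inner (theta z) (phi 0)) / gamma_den t z).

End Extensions.
End Defs.

(* Main.v *)
(* Write S_z for the operator called R(z) in the paper and (f, g) for the integral
   of f g over R_+.  Green's formula gives S_z ((A - z) u) = u on D(A_00), with
   (A - z) u orthogonal to phi_z.  Conversely S_z h lies in D(A_00) when h is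
   continuous, vanishes for large x and satisfies (phi_z, h) = 0.  By density and
   boundedness of S_z,
     A_min = {(S_0 k, k) : (phi_0, k) = 0},  A_max = {(S_0 k + A phi_0, k)}.
   The numbers A and B = (phi_0, k) are boundary values at infinity: A_t is the
   restriction of A_max by A = t B, and A_oo the one by B = 0.  For u in D(A_max),
   <A_max u, u> - <u, A_max u> = conj A B - A conj B, so no A_t has a nonreal
   eigenvalue.  One computes A and B for phi_z by Green's formula, and for S_z h by
   splitting off from h the multiple of (A - z)(omega theta_z) that makes it
   orthogonal to phi_z, since S_z maps (A - z)(omega theta_z) to omega theta_z.
   Then g phi_z + S_z h satisfies the boundary condition exactly for
   g = gamma_t(z) (phi_z, h); the denominator of gamma_t(z) does not vanish because
   phi_z is not an eigenfunction of A_t. *)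
Require Import Defs.
From HB Require Import structures.
From mathcomp Require Import all_boot all_order all_algebra.
From mathcomp Require Import complex.
From mathcomp Require Import all_classical all_reals all_analysis.
From mathcomp Require Import measurable_realfun ring lra.
Import Order.TTheory GRing.Theory Num.Theory.
Import numFieldNormedType.Exports.
Local Open Scope classical_set_scope.
Local Open Scope ring_scope.
Local Open Scope complex_scope.

Set Implicit Arguments.
Unset Strict Implicit.
Unset Printing Implicit Defensive.

(** * Integrals and primitives on the half-line *)

(** All analysis rests on Lagrange's identity, written with the quasi-derivative p u' so that p
    itself is never differentiated. Since phi_z and theta_z have constant Wronskian 1, integrating
    the identity from 0 recovers u from (A - z) u; with zero right-hand side it identifies a
    solution by its initial values. A_max is an adjoint, so it is described by duality: u - S_0 k is
    orthogonal to every g with (phi_0, g) = 0, hence is a multiple of phi_0. The reference point is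
    0 because phi_0 and theta_0 span the extensions and are real: S_0 then commutes with
    conjugation, and the bilinear pairing can replace the scalar product. The condition (phi_z, h) =
    0 is what makes S_z h vanish for large x, so density is needed inside this hyperplane; an
    approximant is pushed back into it by a multiple of a fixed k with (phi_z, k) = 1. Membership in
    D(A_t) constrains u alone and only almost everywhere. The boundary values also involve k, so
    A_max must be single-valued; this is the injectivity of S_0 modulo phi_0. *)

Section RealPrimitive.
Context {R : realType}.
Implicit Types (f g F : R -> R).
Notation mu := (@lebesgue_measure R).
Notation Rplus := (@Rplus R).

Definition L1 f := mu.-integrable Rplus (EFin \o f).
Definition rint f : R := \int[mu]_(x in Rplus) f x.
Definition prim f : R -> R := fun x => \int[mu]_(y in `]0, x[) f y.

Lemma mRplus : measurable (Rplus : set (measurableTypeR R)).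
Proof. exact: measurable_itv. Qed.
Hint Resolve mRplus : core.

Lemma RplusE x : Rplus x = (0 < x) :> Prop.
Proof. by rewrite /Rplus /= in_itv /= andbT. Qed.

Lemma Rplus_gt0 x : Rplus x -> 0 < x.
Proof. by rewrite RplusE. Qed.

Lemma L1_measurable f : L1 f -> measurable_fun Rplus f.
Proof. by move=> /integrableP[/measurable_EFinP]. Qed.

Lemma sub_Rplus x (b : bool) : [set` Interval (BRight 0) (BSide b x)] `<=` Rplus.
Proof. by move=> y; rewrite RplusE /= in_itv /= => /andP[]. Qed.

Lemma L1_itv f x b : L1 f ->
  mu.-integrable [set` Interval (BRight 0) (BSide b x)] (EFin \o f).
Proof. by move=> f1; apply: integrableS f1 => //; exact: sub_Rplus. Qed.

Lemma prim_closed f x : L1 f -> prim f x = \int[mu]_(y in `]0, x]) f y.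
Proof. by move=> f1; rewrite /prim Rintegral_itv_bndo_bndc //; exact: L1_itv. Qed.

Lemma integrable_patch (A : set R) f : measurable A ->
  mu.-integrable A (EFin \o f) -> mu.-integrable setT (EFin \o f \_ A).
Proof.
by move=> mA fA; rewrite -restrict_EFin; apply/integrable_restrict => //=; rewrite setTI.
Qed.

Lemma L1_patch f : L1 f -> mu.-integrable setT (EFin \o f \_ Rplus).
Proof. exact: integrable_patch. Qed.

(** Extension by zero makes the integrand integrable on the whole line, so that results on
    parameterized integrals over [0, x] apply although nothing is known of f outside (0, +oo). *)
Lemma prim_patch f x : L1 f ->
  prim f x = parameterized_integral mu 0 x (f \_ Rplus).
Proof.
move=> f1; rewrite prim_closed // /parameterized_integral -Rintegral_itv_obnd_cbnd.
  apply: eq_Rintegral => y /set_mem /sub_Rplus yR.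
  by rewrite patchE mem_set.
by apply: integrableS (L1_patch f1).
Qed.

Lemma prim_within f b : 0 < b -> L1 f -> {within `[0, b], continuous (prim f)}.
Proof.
move=> b0 f1; have -> : prim f = fun x => parameterized_integral mu 0 x (f \_ Rplus).
  by apply/funext => x; exact: prim_patch.
apply: parameterized_integral_continuous; first exact: ltW.
by apply: integrableS (L1_patch f1).
Qed.

Lemma prim_cvg0 f : L1 f -> prim f x @[x --> (0:R)^'+] --> (0 : R).
Proof.
move=> f1; have /(continuous_within_itvP _ (ltr01 : 0 < 1 :> R))[_ + _] :=
  prim_within ltr01 f1.
(* The limit is [prim f 0], an integral over the empty interval. *)
by rewrite {2}/prim set_itv_ge ?bnd_simp ?ltxx// Rintegral_set0.
Qed.

Lemma prim_continuous f x : 0 < x -> L1 f -> {for x, continuous (prim f)}.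
Proof.
move=> x0 f1; have x1 : 0 < x + 1 by lra.
have /(continuous_within_itvP _ x1)[+ _ _] := prim_within x1 f1.
by apply; rewrite in_itv /= x0; lra.
Qed.

Lemma continuous_measurable_Rplus f :
  (forall x : R, 0 < x -> {for x, continuous f}) -> measurable_fun Rplus f.
Proof.
move=> cf; apply: open_continuous_measurable_fun; first exact: interval_open.
by move=> x /set_mem; rewrite RplusE => x0; exact: cf.
Qed.

Lemma prim_measurable f : L1 f -> measurable_fun Rplus (prim f).
Proof. by move=> f1; apply: continuous_measurable_Rplus => x x0; exact: prim_continuous. Qed.

Lemma rint_split f x : 0 < x -> L1 f ->
  \int[mu]_(y in `]x, +oo[) f y = rint f - prim f x.
Proof.
move=> x0 f1; rewrite prim_closed // /rint -(Rintegral_itvB (a := BRight 0)) //.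
by rewrite bnd_simp ltW.
Qed.

Lemma le_norm_prim f x : L1 f -> `|prim f x| <= rint (fun y => `|f y|).
Proof.
move=> f1; have fx : mu.-integrable `]0, x[ (EFin \o f) by exact: L1_itv.
have fa : L1 (fun y => `|f y|) by exact: integrable_norm.
rewrite (le_trans (le_normr_Rintegral _ fx)) // /rint.
rewrite /Rintegral fine_le //.
- by apply: integrable_fin_num => //; exact: integrable_norm.
- exact: integrable_fin_num.
apply: ge0_subset_integral => //.
- by case/integrableP: fa.
- exact: (@sub_Rplus x true).
Qed.

Lemma le_norm_rint f : L1 f -> `|rint f| <= rint (fun y => `|f y|).
Proof. by move=> f1; exact: le_normr_Rintegral. Qed.

Lemma prim_is_derive f x : 0 < x -> L1 f -> {for x, continuous f} ->
  is_derive x 1 (prim f) (f x).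
Proof.
move=> x0 f1 cf; have -> : prim f = fun x => \int[mu]_(y in `]0, x]) f y.
  by apply/funext => y; exact: prim_closed.
have xu : x < x + 1 by lra.
have [] // := @continuous_FTC1 _ f (BRight 0) x (x + 1) xu.
- exact: L1_itv.
- rewrite derive1E => d1 d2; apply: DeriveDef => //.
Qed.

(** Lebesgue differentiation. It serves the injectivity of the Green operator, where the function is
    merely in L^2 and may have no point of continuity. *)
Lemma prim_is_derive_ae f : L1 f -> {ae mu, forall x : R, 0 < x -> is_derive x 1 (prim f) (f x)}.
Proof.
move=> f1; have -> : prim f = fun x => \int[mu]_(y in `]0, x]) (f \_ Rplus) y.
  apply/funext => y; rewrite prim_closed //; apply: eq_Rintegral => z /set_mem /sub_Rplus ?.
  by rewrite patchE mem_set.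
have fp := L1_patch f1.
have H := @FTC1 R (f \_ Rplus) (BRight 0).
have /H : forall y, mu.-integrable [set` Interval (BRight 0) (BRight y)] (EFin \o f \_ Rplus).
  by move=> y; apply: integrableS fp.
move=> /(_ _)[].
  by have := @integrable_locally R (f \_ Rplus) setT measurableT fp; rewrite patch_setT.
move=> sqnorm [mN N0 NH]; exists sqnorm; split=> // x /= xN; apply: NH => /= Hx; apply: xN => x0.
have [|d1 d2] := Hx; first by rewrite lte_fin.
apply: DeriveDef => //; rewrite -derive1E d2 patchE mem_set //.
by rewrite RplusE.
Qed.

(** A nonzero value would persist on a ball, which has positive measure. *)
Lemma ae_continuous_eq0 f : (forall x : R, 0 < x -> {for x, continuous f}) ->
  {ae mu, forall x : R, 0 < x -> f x = 0} -> forall x : R, 0 < x -> f x = 0.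
Proof.
move=> cf [sqnorm [mN N0 NH]] x x0; apply/eqP; apply: contraT => fx0.
have : \forall y \near x, 0 < y /\ f y != 0.
  near=> y; split; first by near: y; exact: lt_nbhsr.
  near: y; have /cvgr_neq0 := cf x x0; exact.
move=> /nbhs_ballP[e /= e0 He].
have : (mu (ball x e) <= mu sqnorm)%E.
  apply: le_measure => //; rewrite ?inE //; first exact: measurable_ball.
  by move=> y /He[y0 fy]; apply: NH => /= /(_ y0) fy0; rewrite fy0 eqxx in fy.
rewrite N0 (lebesgue_measure_ball x (ltW e0)) leNgt lte_fin.
by rewrite pmulrn_lgt0 // e0.
Unshelve. all: by end_near. Qed.

(** F need not be defined at 0, so its limit replaces F(0): the difference [prim f - F] is constant
    by the mean value theorem and tends to -l at 0. *)
Lemma prim_primitive F f (l x : R) : 0 < x -> L1 f ->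
  (forall x : R, 0 < x -> {for x, continuous f}) ->
  (forall x : R, 0 < x -> is_derive x 1 F (f x)) ->
  F y @[y --> (0:R)^'+] --> l -> prim f x = F x - l.
Proof.
move=> x0 f1 cf dF Fl.
pose G y := prim f y - F y.
have dG (y : R) : 0 < y -> is_derive y 1 G 0.
  move=> y0; have := is_deriveB (prim_is_derive y0 f1 (cf y y0)) (dF y y0).
  by rewrite subrr.
have GE (y : R) : 0 < y -> y < x -> G y = G x.
  move=> y0 yx.
  have [||c _] := @MVT_segment _ G (fun=> 0) y x (ltW yx).
  - by move=> z; rewrite in_itv /= => /andP[yz _]; apply: dG; exact: lt_trans yz.
  - apply: derivable_within_continuous => z; rewrite in_itv /= => /andP[yz _].
    by have [] := dG z (lt_le_trans y0 yz).
  by rewrite mul0r => /eqP; rewrite subr_eq0 => /eqP.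
have Gl : G y @[y --> (0:R)^'+] --> - l.
  by rewrite -(sub0r l); apply: cvgB => //; exact: prim_cvg0.
suff -> : - l = G x by rewrite /G addrC subrK.
apply: (cvg_unique _ Gl) => //.
apply: cvg_near_cst; near=> y; apply: GE.
- by near: y; exact: nbhs_right_gt.
- by near: y; exact: nbhs_right_lt.
Unshelve. all: by end_near. Qed.

(** Fubini on the triangle 0 < y < x. This is the source of the symmetry of the Green operator. *)
Lemma rint_prim_swap a b : L1 a -> L1 b ->
  rint (fun x => b x * prim a x) = rint (fun y => a y * (rint b - prim b y)).
Proof.
move=> a1 b1; have a1' := L1_patch a1; have b1' := L1_patch b1.
set a' := a \_ Rplus in a1'; set b' := b \_ Rplus in b1'.
have ma : measurable_fun setT a' by case/integrableP: a1' => /measurable_EFinP.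
have mb : measurable_fun setT b' by case/integrableP: b1' => /measurable_EFinP.
pose f (xy : R * R) : \bar R := (if xy.2 < xy.1 then b' xy.1 * a' xy.2 else 0)%:E.
have mf : measurable_fun setT f.
  apply/measurable_EFinP; apply: measurable_fun_ifT => //=.
  - by apply: measurable_fun_ltr; [exact: measurable_snd|exact: measurable_fst].
  - by apply: measurable_funM; apply: measurableT_comp.
have intf : (mu \x mu)%E.-integrable setT f.
  (* Tonelli: the kernel is dominated by |b'(x)| |a'(y)|, whose iterated integral is the product of
     two finite norms. *)
  apply/integrable12ltyP => //.
  apply: (@le_lt_trans _ _ (\int[mu]_x (`|(b' x)%:E| * \int[mu]_y `|(a' y)%:E|))%E).
    apply: ge0_le_integral => //=.
    - by move=> x _; apply: integral_ge0.
    - apply: (measurable_fun_fubini_tonelli_F (m2 := mu) (abse \o f)) => //=.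
      exact: measurableT_comp.
    - apply: emeasurable_funM => //.
      by apply/measurable_EFinP; apply: measurableT_comp.
    have ma1 : measurable_fun setT (fun y => `|a' y|%:E).
      by apply/measurable_EFinP; apply: measurableT_comp.
    move=> x _; rewrite -ge0_integralZl //=.
    apply: ge0_le_integral => //=.
    - apply: (@measurableT_comp _ _ _ _ _ _ abse _ (fun y => f (x, y))) => //.
      exact: (measurableT_comp mf (measurable_pair1 x)).
    - by apply: measurable_funeM.
    - move=> y _; rewrite lee_fin; case: ifPn => _; first by rewrite normrM.
      by rewrite normr0 mulr_ge0.
  have mb1 : measurable_fun setT (fun y => `|b' y|%:E).
    by apply/measurable_EFinP; apply: measurableT_comp.
  rewrite ge0_integralZr //=; last by apply: integral_ge0.
  apply: lte_mul_pinfty; first by apply: integral_ge0.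
  - by rewrite ge0_fin_numE; [case/integrableP: b1'|apply: integral_ge0].
  - by case/integrableP: a1'.
have := Fubini intf.
have -> : (fun x => \int[mu]_y f (x, y))%E = fun x => (b' x * prim a x)%:E.
  apply/funext => x; rewrite /prim Rintegral_mkcond /Rintegral EFinM fineK; last first.
    by apply: integrable_fin_num => //; apply: integrable_patch => //; exact: L1_itv.
  rewrite -integralZl //; last by apply: integrable_patch => //; exact: L1_itv.
  apply: eq_integral => y _; rewrite -EFinM /f /=; congr EFin.
  rewrite /a' !patchE; case: (ltP y x) => yx.
    suff -> : (y \in `]0, x[%classic) = (y \in Rplus) by [].
    by apply/idP/idP => /set_mem H; apply/mem_set; move: H; rewrite RplusE /= in_itv /= yx andbT.
  rewrite (@memNset _ `]0, x[%classic) ?mulr0 //= in_itv /= => /andP[_].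
  by rewrite ltNge yx.
have -> : (fun y => \int[mu]_x f (x, y))%E = fun y => (a' y * (rint b - prim b y))%:E.
  apply/funext => y; have [y0|y0] := ltP 0 y; last first.
    rewrite /a' patchE memNset ?mul0r ?RplusE /=; last by rewrite ltNge y0.
    rewrite integral0_eq // => x _; rewrite /f /a' /= patchE memNset ?mulr0 ?if_same //.
    by rewrite RplusE ltNge y0.
  have by1 : mu.-integrable setT (EFin \o b \_ `]y, +oo[).
    apply: integrable_patch => //; apply: integrableS b1 => //.
    by move=> z; rewrite RplusE /= in_itv /= andbT; exact: lt_trans.
  rewrite -rint_split // Rintegral_mkcond /Rintegral EFinM fineK; last exact: integrable_fin_num.
  rewrite -integralZl //.
  apply: eq_integral => x _; rewrite -EFinM /f /=; congr EFin.
  case: (ltP y x) => yx.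
    rewrite mulrC; congr (_ * _); rewrite /b' !patchE !mem_set //= ?RplusE ?in_itv /= ?andbT //.
    exact: lt_trans yx.
  rewrite [in RHS]patchE (@memNset _ `]y, +oo[%classic) ?mulr0 //= in_itv /= andbT.
  by rewrite ltNge yx.
move=> E; rewrite /rint [LHS]Rintegral_mkcond [RHS]Rintegral_mkcond /Rintegral.
have H c g : (fun x => c x * g x) \_ Rplus = fun x => (c \_ Rplus) x * g x.
  by apply/funext => x; rewrite !patchE; case: ifP => // _; rewrite mul0r.
by rewrite !H E.
Qed.

End RealPrimitive.

(** * Complex-valued functions *)

Section ComplexParts.
Context {R : realType}.
Implicit Types (u v : R -> R[i]).

Lemma cReD (a b : R[i]) : complex.Re (a + b) = complex.Re a + complex.Re b.
Proof. by case: a b => [a1 a2] [b1 b2]. Qed.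
Lemma cImD (a b : R[i]) : complex.Im (a + b) = complex.Im a + complex.Im b.
Proof. by case: a b => [a1 a2] [b1 b2]. Qed.
Lemma cReM (a b : R[i]) :
  complex.Re (a * b) = complex.Re a * complex.Re b - complex.Im a * complex.Im b.
Proof. by case: a b => [a1 a2] [b1 b2]. Qed.
Lemma cImM (a b : R[i]) :
  complex.Im (a * b) = complex.Re a * complex.Im b + complex.Im a * complex.Re b.
Proof. by case: a b => [a1 a2] [b1 b2]. Qed.
Lemma cReN (a : R[i]) : complex.Re (- a) = - complex.Re a.
Proof. by case: a. Qed.
Lemma cImN (a : R[i]) : complex.Im (- a) = - complex.Im a.
Proof. by case: a. Qed.
Lemma cReC (a : R[i]) : complex.Re (a^*)%C = complex.Re a.
Proof. by case: a. Qed.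
Lemma cImC (a : R[i]) : complex.Im (a^*)%C = - complex.Im a.
Proof. by case: a. Qed.

Lemma complex_ext (a b : R[i]) :
  complex.Re a = complex.Re b -> complex.Im a = complex.Im b -> a = b.
Proof. by case: a b => [a1 a2] [b1 b2] /= -> ->. Qed.

Lemma normc_sqr (a : R[i]) :
  Normc.normc a ^+ 2 = complex.Re a ^+ 2 + complex.Im a ^+ 2.
Proof.
by case: a => a b /=; rewrite sqr_sqrtr // addr_ge0 // sqr_ge0.
Qed.

Lemma conjcM (a b : R[i]) : (a * b)^*%C = a^*%C * b^*%C.
Proof. exact: rmorphM. Qed.
Lemma conjcD (a b : R[i]) : (a + b)^*%C = a^*%C + b^*%C.
Proof. exact: rmorphD. Qed.
Lemma conjcB (a b : R[i]) : (a - b)^*%C = a^*%C - b^*%C.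
Proof. exact: rmorphB. Qed.
End ComplexParts.

(** * Limits and derivatives by real and imaginary parts *)

Section ComplexLimits.
Context {R : realType} {F : set_system R} {FF : ProperFilter F}.
Implicit Types (u v : R -> R[i]) (a b : R[i]).

(** The filter is a parameter so that the same rules serve the limit at 0 from the right, where this
    is [lim0], and continuity at a point. *)
Definition clim (F : set_system R) u a :=
  (re u x @[x --> F] --> complex.Re a) /\ (im u x @[x --> F] --> complex.Im a).

Lemma clim_cst a : clim F (fun=> a) a.
Proof. by split; exact: cvg_cst. Qed.

Lemma climD u v a b : clim F u a -> clim F v b -> clim F (fun x => u x + v x) (a + b).
Proof.
move=> [u1 u2] [v1 v2]; split; rewrite ?cReD ?cImD.
- by under eq_fun do rewrite /re cReD; exact: cvgD.
- by under eq_fun do rewrite /im cImD; exact: cvgD.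
Qed.

Lemma climN u a : clim F u a -> clim F (fun x => - u x) (- a).
Proof.
move=> [u1 u2]; split; rewrite ?cReN ?cImN.
- by under eq_fun do rewrite /re cReN; exact: cvgN.
- by under eq_fun do rewrite /im cImN; exact: cvgN.
Qed.

Lemma climB u v a b : clim F u a -> clim F v b -> clim F (fun x => u x - v x) (a - b).
Proof. by move=> ua vb; apply: climD => //; exact: climN. Qed.

Lemma climM u v a b : clim F u a -> clim F v b -> clim F (fun x => u x * v x) (a * b).
Proof.
move=> [u1 u2] [v1 v2]; split; rewrite ?cReM ?cImM.
- by under eq_fun do rewrite /re cReM; apply: cvgB; exact: cvgM.
- by under eq_fun do rewrite /im cImM; apply: cvgD; exact: cvgM.
Qed.

Lemma clim_conj u a : clim F u a -> clim F (fun x => (u x)^*%C) a^*%C.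
Proof.
move=> [u1 u2]; split; rewrite ?cReC ?cImC.
- by under eq_fun do rewrite /re cReC.
- by under eq_fun do rewrite /im cImC; exact: cvgN.
Qed.

Lemma clim_real (f : R -> R) (l : R) : f x @[x --> F] --> l ->
  clim F (fun x => (f x)%:C) l%:C.
Proof. by move=> fl; split => //=; exact: cvg_cst. Qed.

Lemma clim_near u v a : (\forall x \near F, u x = v x) -> clim F u a -> clim F v a.
Proof.
move=> uv [u1 u2]; split.
- apply: (cvg_trans _ u1); apply: near_eq_cvg.
  by apply: filterS uv => x E; rewrite /re E.
- apply: (cvg_trans _ u2); apply: near_eq_cvg.
  by apply: filterS uv => x E; rewrite /im E.
Qed.

End ComplexLimits.

Notation ccont u x := (clim (nbhs x) u (u x)).

Section ComplexDerivative.
Context {R : realType}.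
Implicit Types (u v : R -> R[i]) (a b : R[i]) (x : R).

(** A relation rather than the total function [cderiv]: it carries differentiability along, and
    derivatives can be assembled by rules and then corrected by [ring] through [cder_eq]. *)
Definition cder u x a :=
  is_derive x 1 (re u) (complex.Re a) /\ is_derive x 1 (im u) (complex.Im a).

Lemma cder_eq u x a b : cder u x a -> a = b -> cder u x b.
Proof. by move=> + <-. Qed.

Lemma cder_cst a x : cder (fun=> a) x 0.
Proof. by split; exact: is_derive_cst. Qed.

Lemma cderD u v a b x : cder u x a -> cder v x b -> cder (fun x => u x + v x) x (a + b).
Proof.
move=> [u1 u2] [v1 v2]; split; rewrite ?cReD ?cImD.
- by rewrite (_ : re _ = re u + re v); [exact: is_deriveD|apply/funext => y; rewrite /re cReD].
- by rewrite (_ : im _ = im u + im v); [exact: is_deriveD|apply/funext => y; rewrite /im cImD].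
Qed.

Lemma cderN u a x : cder u x a -> cder (fun x => - u x) x (- a).
Proof.
move=> [u1 u2]; split; rewrite ?cReN ?cImN.
- by rewrite (_ : re _ = - re u); [exact: is_deriveN|apply/funext => y; rewrite /re cReN].
- by rewrite (_ : im _ = - im u); [exact: is_deriveN|apply/funext => y; rewrite /im cImN].
Qed.

Lemma cderB u v a b x : cder u x a -> cder v x b -> cder (fun x => u x - v x) x (a - b).
Proof. by move=> ua vb; apply: cderD => //; exact: cderN. Qed.

Lemma cderM u v a b x : cder u x a -> cder v x b ->
  cder (fun x => u x * v x) x (a * v x + u x * b).
Proof.
move=> [u1 u2] [v1 v2]; split; rewrite ?cReD ?cImD ?cReM ?cImM.
- rewrite (_ : re _ = re u * re v - im u * im v); last by apply/funext => y; rewrite /re cReM.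
  apply: (is_derive_eq (is_deriveB (is_deriveM u1 v1) (is_deriveM u2 v2))).
  by rewrite /GRing.scale /= /re /im; ring.
- rewrite (_ : im _ = re u * im v + im u * re v); last by apply/funext => y; rewrite /im cImM.
  apply: (is_derive_eq (is_deriveD (is_deriveM u1 v2) (is_deriveM u2 v1))).
  by rewrite /GRing.scale /= /re /im; ring.
Qed.

Lemma cder_conj u a x : cder u x a -> cder (fun x => (u x)^*%C) x a^*%C.
Proof.
move=> [u1 u2]; split; rewrite ?cReC ?cImC.
- by rewrite (_ : re _ = re u) //; apply/funext => y; rewrite /re cReC.
- by rewrite (_ : im _ = - im u); [exact: is_deriveN|apply/funext => y; rewrite /im cImC].
Qed.

Lemma cder_real (f : R -> R) (l x : R) : is_derive x 1 f l ->
  cder (fun x => (f x)%:C) x l%:C.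
Proof. by move=> fl; split => //=; exact: is_derive_cst. Qed.

Lemma cder_ccont u a x : cder u x a -> ccont u x.
Proof.
move=> [[u1 _] [u2 _]]; split.
- exact/differentiable_continuous/derivable1_diffP.
- exact/differentiable_continuous/derivable1_diffP.
Qed.

Lemma cder_near u v a x : (\forall y \near x, u y = v y) -> cder u x a -> cder v x a.
Proof.
move=> uv [u1 u2]; split.
- by apply: near_eq_is_derive u1; rewrite ?oner_eq0 //; apply: filterS uv => y E; rewrite /re E.
- by apply: near_eq_is_derive u2; rewrite ?oner_eq0 //; apply: filterS uv => y E; rewrite /im E.
Qed.

Lemma cder_unique u a b x : cder u x a -> cder u x b -> a = b.
Proof.
move=> [u1 u2] [v1 v2]; apply: complex_ext.
- by rewrite -(@derive_val _ _ _ _ _ _ _ u1) (@derive_val _ _ _ _ _ _ _ v1).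
- by rewrite -(@derive_val _ _ _ _ _ _ _ u2) (@derive_val _ _ _ _ _ _ _ v2).
Qed.

Lemma cder_cderiv u a x : cder u x a -> cderiv u x = a.
Proof.
move=> [u1 u2]; rewrite /cderiv !derive1E; apply: complex_ext => /=.
- by rewrite (@derive_val _ _ _ _ _ _ _ u1).
- by rewrite (@derive_val _ _ _ _ _ _ _ u2).
Qed.

End ComplexDerivative.

Section RealIntegrable.
Context {R : realType}.
Notation mu := (@lebesgue_measure R).
Context (D : set (measurableTypeR R)) (mD : measurable D).
Implicit Types (f g : R -> R) (P Q S : R -> Prop).

Lemma rintegrableD f g : mu.-integrable D (EFin \o f) -> mu.-integrable D (EFin \o g) ->
  mu.-integrable D (EFin \o (fun x => f x + g x)).
Proof. by move=> f1 g1; exact: (integrableD mD f1 g1). Qed.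

Lemma rintegrableB f g : mu.-integrable D (EFin \o f) -> mu.-integrable D (EFin \o g) ->
  mu.-integrable D (EFin \o (fun x => f x - g x)).
Proof. by move=> f1 g1; exact: (integrableB mD f1 g1). Qed.

Lemma rintegrableZ (k : R) f : mu.-integrable D (EFin \o f) ->
  mu.-integrable D (EFin \o (fun x => k * f x)).
Proof. by move=> f1; exact: (integrableZl mD k f1). Qed.

Lemma eq_rintegrable f g : (forall x, D x -> f x = g x) ->
  mu.-integrable D (EFin \o f) -> mu.-integrable D (EFin \o g).
Proof.
move=> fg f1; apply: (@eq_integrable _ _ _ mu D mD (EFin \o f)) => //.
by move=> x /set_mem Dx /=; rewrite fg.
Qed.

Lemma ae_imp P Q : (forall x, P x -> Q x) ->
  {ae mu, forall x, P x} -> {ae mu, forall x, Q x}.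
Proof. by move=> PQ; apply: filterS PQ; exact: (ae_filter_ringOfSetsType mu). Qed.

Lemma ae_imp2 P Q S : (forall x, P x -> Q x -> S x) ->
  {ae mu, forall x, P x} -> {ae mu, forall x, Q x} -> {ae mu, forall x, S x}.
Proof. by move=> PQ; apply: filterS2 PQ; exact: (ae_filter_ringOfSetsType mu). Qed.

End RealIntegrable.

(** * Integrals and primitives of complex-valued functions *)

Section ComplexIntegral.
Context {R : realType}.
Notation mu := (@lebesgue_measure R).
Notation Rplus := (@Rplus R).
Implicit Types (u v a b : R -> R[i]) (c : R[i]) (D : set R).

Definition cintegrable D u :=
  mu.-integrable D (EFin \o re u) /\ mu.-integrable D (EFin \o im u).
Definition cL1 u := cintegrable Rplus u.
Definition cint u : R[i] := cintegral Rplus u.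
Definition cprim u x : R[i] := cintegral `]0, x[ u.

Lemma cprim_parts u x : cprim u x = prim (re u) x +i* prim (im u) x.
Proof. by []. Qed.

Lemma cL1_itv u x : cL1 u -> cintegrable `]0, x[ u.
Proof. by move=> [u1 u2]; split; exact: L1_itv. Qed.

Section on_set.
Context (D : set (measurableTypeR R)) (mD : measurable D).

Lemma cintegrable0 : cintegrable D (fun=> 0).
Proof. by split; exact: integrable0. Qed.

Lemma cintegrableD u v : cintegrable D u -> cintegrable D v ->
  cintegrable D (fun x => u x + v x).
Proof.
move=> [u1 u2] [v1 v2]; split.
- by apply: (eq_rintegrable mD _ (rintegrableD mD u1 v1)) => x _; rewrite /re cReD.
- by apply: (eq_rintegrable mD _ (rintegrableD mD u2 v2)) => x _; rewrite /im cImD.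
Qed.

Lemma cintegralD u v : cintegrable D u -> cintegrable D v ->
  cintegral D (fun x => u x + v x) = cintegral D u + cintegral D v.
Proof.
move=> [u1 u2] [v1 v2]; apply: complex_ext => /=.
- by under eq_Rintegral do rewrite /re cReD; rewrite RintegralD.
- by under eq_Rintegral do rewrite /im cImD; rewrite RintegralD.
Qed.

Lemma cintegrableZ c u : cintegrable D u -> cintegrable D (fun x => c * u x).
Proof.
move=> [u1 u2]; split.
- apply: (eq_rintegrable mD _ (rintegrableB mD (rintegrableZ mD (complex.Re c) u1)
    (rintegrableZ mD (complex.Im c) u2))) => x _.
  by rewrite /re cReM.
- apply: (eq_rintegrable mD _ (rintegrableD mD (rintegrableZ mD (complex.Re c) u2)
    (rintegrableZ mD (complex.Im c) u1))) => x _.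
  by rewrite /im cImM.
Qed.

Lemma cintegralZ c u : cintegrable D u ->
  cintegral D (fun x => c * u x) = c * cintegral D u.
Proof.
move=> [u1 u2]; apply: complex_ext; rewrite ?cReM ?cImM /=.
- under eq_Rintegral do rewrite /re cReM.
  rewrite RintegralB //; [|exact: rintegrableZ..].
  by rewrite !RintegralZl.
- under eq_Rintegral do rewrite /im cImM.
  rewrite RintegralD //; [|exact: rintegrableZ..].
  by rewrite !RintegralZl.
Qed.

Lemma cintegrableN u : cintegrable D u -> cintegrable D (fun x => - u x).
Proof.
by move=> u1; have := cintegrableZ (-1) u1; under eq_fun do rewrite mulN1r.
Qed.

Lemma cintegralN u : cintegrable D u -> cintegral D (fun x => - u x) = - cintegral D u.
Proof.
by move=> u1; have := cintegralZ (-1) u1; under eq_fun do rewrite mulN1r; rewrite mulN1r.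
Qed.

Lemma cintegrableB u v : cintegrable D u -> cintegrable D v ->
  cintegrable D (fun x => u x - v x).
Proof. by move=> u1 v1; apply: cintegrableD => //; exact: cintegrableN. Qed.

Lemma cintegralB u v : cintegrable D u -> cintegrable D v ->
  cintegral D (fun x => u x - v x) = cintegral D u - cintegral D v.
Proof.
by move=> u1 v1; rewrite cintegralD ?cintegralN //; exact: cintegrableN.
Qed.

Lemma cintegral_conj u : cintegrable D u ->
  cintegral D (fun x => (u x)^*%C) = (cintegral D u)^*%C.
Proof.
move=> [u1 u2]; apply: complex_ext => /=.
- by under eq_Rintegral do rewrite /re cReC.
- under eq_Rintegral do rewrite /im cImC -mulN1r.
  by rewrite RintegralZl // mulN1r.
Qed.

Lemma eq_cintegral u v : (forall x, D x -> u x = v x) -> cintegral D u = cintegral D v.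
Proof.
move=> uv; apply: complex_ext => /=; apply: eq_Rintegral => x /set_mem Dx;
  by rewrite /re /im uv.
Qed.

Lemma eq_cintegrable u v : (forall x, D x -> u x = v x) ->
  cintegrable D u -> cintegrable D v.
Proof.
move=> uv [u1 u2]; split.
- by apply: (eq_rintegrable mD _ u1) => x Dx; rewrite /re uv.
- by apply: (eq_rintegrable mD _ u2) => x Dx; rewrite /im uv.
Qed.

Lemma ae_eq_cintegral u v : cintegrable D u -> cintegrable D v ->
  u = v %[ae mu in D] -> cintegral D u = cintegral D v.
Proof.
move=> [u1 u2] [v1 v2] uv; apply: complex_ext => /=; congr fine; apply: ae_eq_integral => //.
- exact: measurable_int u1.
- exact: measurable_int v1.
- by apply: ae_imp uv => x + Dx => /(_ Dx) E; rewrite /re E.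
- exact: measurable_int u2.
- exact: measurable_int v2.
- by apply: ae_imp uv => x + Dx => /(_ Dx) E; rewrite /im E.
Qed.

End on_set.

Lemma cprim_ccont u (x : R) : 0 < x -> cL1 u -> ccont (cprim u) x.
Proof. by move=> x0 [u1 u2]; split; exact: prim_continuous. Qed.

Lemma cprim_lim0 u : cL1 u -> clim (0^'+) (cprim u) 0.
Proof. by move=> [u1 u2]; split; exact: prim_cvg0. Qed.

Lemma cprim_cder u (x : R) : 0 < x -> cL1 u -> ccont u x -> cder (cprim u) x (u x).
Proof. by move=> x0 [u1 u2] [c1 c2]; split; exact: prim_is_derive. Qed.

Lemma cprim_cder_ae u : cL1 u -> {ae mu, forall x : R, 0 < x -> cder (cprim u) x (u x)}.
Proof.
move=> [u1 u2]; apply: ae_imp2 (prim_is_derive_ae u1) (prim_is_derive_ae u2) => x H1 H2 x0.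
by split; [exact: H1|exact: H2].
Qed.

Lemma cprim_primitive u v l (x : R) : 0 < x -> cL1 u -> (forall x : R, 0 < x -> ccont u x) ->
  (forall x : R, 0 < x -> cder v x (u x)) -> clim (0^'+) v l -> cprim u x = v x - l.
Proof.
move=> x0 [u1 u2] cu dv [l1 l2]; apply: complex_ext; rewrite ?cReD ?cImD ?cReN ?cImN /=.
- by apply: (prim_primitive x0 u1 _ _ l1) => y y0; [have [] := cu y y0|have [] := dv y y0].
- by apply: (prim_primitive x0 u2 _ _ l2) => y y0; [have [] := cu y y0|have [] := dv y y0].
Qed.

Lemma cint_split u x : 0 < x -> cL1 u -> cintegral `]x, +oo[ u = cint u - cprim u x.
Proof.
move=> x0 [u1 u2]; apply: complex_ext; rewrite ?cReD ?cImD ?cReN ?cImN /=.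
- exact: rint_split.
- exact: rint_split.
Qed.

(** The primitive is bounded by the L^1 norm of g. *)
Lemma L1_mul_prim (f g : R -> R) : L1 f -> L1 g -> L1 (fun x => f x * prim g x).
Proof.
move=> f1 g1; apply: (@le_integrable _ _ _ mu _ mRplus _
    (EFin \o (fun x => rint (fun y => `|g y|) * `|f x|))).
- by apply/measurable_EFinP; apply: measurable_funM; [exact: L1_measurable|exact: prim_measurable].
- move=> x _; rewrite /= lee_fin !normrM normr_id mulrC.
  by rewrite ler_wpM2r // (le_trans (le_norm_prim _ g1)) // ler_norm.
- by apply: (rintegrableZ mRplus); exact: integrable_norm.
Qed.

Lemma cL1_mul_prim u v : cL1 u -> cL1 v -> cL1 (fun x => u x * cprim v x).
Proof.
move=> [u1 u2] [v1 v2]; split.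
- apply: (eq_rintegrable mRplus _ (rintegrableB mRplus (L1_mul_prim u1 v1) (L1_mul_prim u2 v2))).
  by move=> x _; rewrite /re cReM.
- apply: (eq_rintegrable mRplus _ (rintegrableD mRplus (L1_mul_prim u1 v2) (L1_mul_prim u2 v1))).
  by move=> x _; rewrite /im cImM.
Qed.

Lemma cint_prim_swap a b : cL1 a -> cL1 b ->
  cint (fun x => b x * cprim a x) = cint (fun y => a y * (cint b - cprim b y)).
Proof.
move=> [a1 a2] [b1 b2].
have tailE (f g : R -> R) : L1 f -> L1 g -> L1 (fun y => f y * (rint g - prim g y)).
  move=> f1 g1; have := rintegrableB mRplus (rintegrableZ mRplus (rint g) f1) (L1_mul_prim f1 g1).
  apply: (eq_rintegrable mRplus).
  by move=> x _; rewrite mulrBr [rint g * _]mulrC.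
apply: complex_ext => /=.
- under eq_Rintegral do rewrite /re cReM.
  under [RHS]eq_Rintegral do rewrite /re cReM cReD cImD cReN cImN.
  rewrite !RintegralB; try exact: mRplus; try exact: L1_mul_prim; try exact: tailE.
  by congr (_ - _); exact: rint_prim_swap.
- under eq_Rintegral do rewrite /im cImM.
  under [RHS]eq_Rintegral do rewrite /im cImM cReD cImD cReN cImN.
  rewrite !RintegralD; try exact: mRplus; try exact: L1_mul_prim; try exact: tailE.
  (* The swap exchanges the roles of a and b, so the two mixed products appear in the opposite
     order. *)
  by rewrite addrC; congr (_ + _); exact: rint_prim_swap.
Qed.

End ComplexIntegral.

(** * The space L^2 *)

Section CauchySchwarz.
Context {R : realType}.
Notation mu := (@lebesgue_measure R).
Notation Rplus := (@Rplus R).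
Implicit Types (f g h : R -> R).

(** The discriminant of a quadratic polynomial in t that is nowhere negative. For a = 0 it is
    affine, and the choice of t below refutes x != 0; otherwise t = x / a is the minimum. *)
Lemma disc_le (a b x : R) : 0 <= a -> (forall t : R, 2 * t * x <= t ^+ 2 * a + b) ->
  x ^+ 2 <= a * b.
Proof.
rewrite le_eqVlt => /predU1P[<- H|a0 H].
  rewrite mul0r; have [->|x0] := eqVneq x 0; first by rewrite expr0n.
  have := H ((b + 1) / (2 * x)); rewrite mulr0 add0r.
  rewrite (_ : 2 * ((b + 1) / (2 * x)) * x = b + 1); last by field.
  by move=> bb; lra.
have := H (x / a); rewrite (_ : (x / a) ^+ 2 * a = x ^+ 2 / a); last by field; lra.
rewrite (_ : 2 * (x / a) * x = 2 * (x ^+ 2 / a)); last by field; lra.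
move=> {}H; have {}H : x ^+ 2 / a <= b by lra.
by rewrite mulrC -ler_pdivrMr.
Qed.

Lemma disc_ge (a b x t : R) : 0 <= a -> 0 <= b -> x ^+ 2 <= a * b ->
  2 * t * `|x| <= t ^+ 2 * a + b.
Proof.
rewrite -(real_normK (num_real x)).
have := normr_ge0 x; move: `|x| => {}x x0.
rewrite le_eqVlt => /predU1P[<- b0|a0 b0 H].
  rewrite mul0r => x2; have -> : x = 0 by apply/eqP; rewrite -sqrf_eq0 eq_le x2 sqr_ge0.
  by rewrite !mulr0 add0r.
rewrite -(ler_pM2l a0).
by have := sqr_ge0 (t * a - x); rewrite sqrrB; nra.
Qed.

(** The pointwise bound gives 2 |h| <= f + g. *)
Lemma L1_CS f g h : L1 f -> L1 g -> measurable_fun Rplus h ->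
  (forall x : R, 0 < x -> 0 <= f x) -> (forall x : R, 0 < x -> 0 <= g x) ->
  (forall x : R, 0 < x -> h x ^+ 2 <= f x * g x) -> L1 h.
Proof.
move=> f1 g1 mh f0 g0 H.
apply: (@le_integrable _ _ _ mu _ mRplus _ (EFin \o (fun x => f x + g x))).
- exact/measurable_EFinP.
- move=> x /Rplus_gt0 x0 /=; rewrite lee_fin [leRHS]ger0_norm ?addr_ge0 ?f0 ?g0 //.
  have := disc_ge 1 (f0 x x0) (g0 x x0) (H x x0).
  by have := normr_ge0 (h x); lra.
- exact: (rintegrableD mRplus).
Qed.

Lemma rintZ (k : R) f : L1 f -> rint (fun x => k * f x) = k * rint f.
Proof. by move=> f1; rewrite /rint RintegralZl //; exact: mRplus. Qed.

Lemma rintD f g : L1 f -> L1 g -> rint (fun x => f x + g x) = rint f + rint g.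
Proof. by move=> f1 g1; exact: (RintegralD mRplus f1 g1). Qed.

Lemma L1Z (k : R) f : L1 f -> L1 (fun x => k * f x).
Proof. exact: (rintegrableZ mRplus). Qed.

Lemma L1D f g : L1 f -> L1 g -> L1 (fun x => f x + g x).
Proof. exact: (rintegrableD mRplus). Qed.

(** The form h^2 <= f g avoids square roots. It is meant for h the real or imaginary part of u v,
    with f = |u|^2 and g = |v|^2. *)
Lemma rint_CS f g h : L1 f -> L1 g -> measurable_fun Rplus h ->
  (forall x : R, 0 < x -> 0 <= f x) -> (forall x : R, 0 < x -> 0 <= g x) ->
  (forall x : R, 0 < x -> h x ^+ 2 <= f x * g x) ->
  (rint (fun x => `|h x|)) ^+ 2 <= rint f * rint g.
Proof.
move=> f1 g1 mh f0 g0 H; have h1 := L1_CS f1 g1 mh f0 g0 H.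
have h1' : L1 (fun x => `|h x|) by exact: integrable_norm.
(* Integrate the pointwise quadratic inequality for each fixed t, then take the discriminant of the
   integrals. *)
apply: disc_le => [|t].
  by apply: Rintegral_ge0 => x /Rplus_gt0; exact: f0.
rewrite -(rintZ _ h1') -(rintZ _ f1) -rintD //; last exact: L1Z.
apply: le_Rintegral; [exact: mRplus|exact: L1Z|by apply: L1D => //; exact: L1Z|].
by move=> x /Rplus_gt0 x0; apply: disc_ge; [exact: f0|exact: g0|exact: H].
Qed.

End CauchySchwarz.

Section L2.
Context {R : realType}.
Notation mu := (@lebesgue_measure R).
Notation Rplus := (@Rplus R).
Implicit Types (u v w : R -> R[i]) (c : R[i]).

Definition cmeas u := measurable_fun Rplus (re u) /\ measurable_fun Rplus (im u).
Definition sq u : R -> R := fun x => Normc.normc (u x) ^+ 2.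
Definition sqnorm u : R := rint (sq u).

Lemma sqE u x : sq u x = re u x ^+ 2 + im u x ^+ 2.
Proof. exact: normc_sqr. Qed.

Lemma sq_ge0 u x : 0 <= sq u x. Proof. exact: sqr_ge0. Qed.
Hint Resolve sq_ge0 : core.

Lemma sqnorm_ge0 u : 0 <= sqnorm u.
Proof. by apply: Rintegral_ge0 => x _. Qed.

Lemma sq_measurable u : cmeas u -> measurable_fun Rplus (sq u).
Proof.
move=> [m1 m2]; rewrite (_ : sq u = fun x => re u x ^+ 2 + im u x ^+ 2).
  by apply: measurable_funD; exact: measurable_funX.
by apply/funext => x; rewrite sqE.
Qed.

Lemma L2P u : L2 u <-> cmeas u /\ L1 (sq u).
Proof.
have E : (\int[mu]_(x in Rplus) `|(sq u x)%:E| = \int[mu]_(x in Rplus) (sq u x)%:E)%E.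
  by apply: eq_integral => x _; rewrite gee0_abs // lee_fin.
split=> [[m1 m2 i]|[[m1 m2] /integrableP[_ i]]].
  split=> //; apply/integrableP; split; last by rewrite /= E.
  by apply/measurable_EFinP; exact: sq_measurable.
by split => //; rewrite -E.
Qed.

Lemma L2_meas u : L2 u -> cmeas u. Proof. by case/L2P. Qed.
Lemma L2_sq u : L2 u -> L1 (sq u). Proof. by case/L2P. Qed.

Lemma L2_le u (g : R -> R) : cmeas u -> L1 g -> (forall x : R, 0 < x -> sq u x <= g x) -> L2 u.
Proof.
move=> mu_ g1 ug; apply/L2P; split=> //.
apply: (@le_integrable _ _ _ mu _ mRplus _ (EFin \o g)) => //.
- by apply/measurable_EFinP; exact: sq_measurable.
- move=> x /Rplus_gt0 x0 /=; rewrite lee_fin ger0_norm //.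
  by rewrite (le_trans (ug x x0)) // ler_norm.
Qed.

Lemma sqM u v x : sq (fun x => u x * v x) x = sq u x * sq v x.
Proof. by rewrite /sq Normc.normcM exprMn. Qed.

Lemma sqD u v x : sq (fun x => u x + v x) x <= 2 * sq u x + 2 * sq v x.
Proof.
rewrite !sqE /re /im cReD cImD.
move: (complex.Re (u x)) (complex.Im (u x)) (complex.Re (v x)) (complex.Im (v x)) => a b c d.
have := sqr_ge0 (a - c); have := sqr_ge0 (b - d); nra.
Qed.

Lemma sqN u x : sq (fun x => - u x) x = sq u x.
Proof. by rewrite !sqE /re /im cReN cImN !sqrrN. Qed.

Lemma sq_conj u x : sq (fun x => (u x)^*%C) x = sq u x.
Proof. by rewrite !sqE /re /im cReC cImC !sqrrN. Qed.

Lemma cmeasD u v : cmeas u -> cmeas v -> cmeas (fun x => u x + v x).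
Proof.
move=> [u1 u2] [v1 v2]; split.
- by apply: (eq_measurable_fun (fun x => re u x + re v x)) => [y _|]; [rewrite /re cReD|exact: measurable_funD].
- by apply: (eq_measurable_fun (fun x => im u x + im v x)) => [x _|]; [rewrite /im cImD|exact: measurable_funD].
Qed.

Lemma cmeasM u v : cmeas u -> cmeas v -> cmeas (fun x => u x * v x).
Proof.
move=> [u1 u2] [v1 v2]; split.
- apply: (eq_measurable_fun (fun x => re u x * re v x - im u x * im v x)) => [x _|].
    by rewrite /re cReM.
  by apply: measurable_funB; exact: measurable_funM.
- apply: (eq_measurable_fun (fun x => re u x * im v x + im u x * re v x)) => [x _|].
    by rewrite /im cImM.
  by apply: measurable_funD; exact: measurable_funM.
Qed.

Lemma cmeas_cst c : cmeas (fun=> c).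
Proof. by split; exact: measurable_cst. Qed.

Lemma cmeas_ccont u : (forall x : R, 0 < x -> ccont u x) -> cmeas u.
Proof.
by move=> cu; split; apply: continuous_measurable_Rplus => x x0; have [] := cu x x0.
Qed.

Lemma cmeas_conj u : cmeas u -> cmeas (fun x => (u x)^*%C).
Proof.
move=> [u1 u2]; split.
- by apply: (eq_measurable_fun (re u)) => [x _|//]; rewrite /re cReC.
- by apply: (eq_measurable_fun (fun x => - im u x)) => [x _|]; [rewrite /im cImC|exact: measurableT_comp].
Qed.

Lemma L2D u v : L2 u -> L2 v -> L2 (fun x => u x + v x).
Proof.
move=> /L2P[u1 u2] /L2P[v1 v2].
apply: (L2_le (cmeasD u1 v1)
  (rintegrableD mRplus (rintegrableZ mRplus 2 u2) (rintegrableZ mRplus 2 v2))).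
by move=> x _; exact: sqD.
Qed.

Lemma L2Z c u : L2 u -> L2 (fun x => c * u x).
Proof.
move=> /L2P[u1 u2].
apply: (L2_le (cmeasM (cmeas_cst c) u1) (rintegrableZ mRplus (Normc.normc c ^+ 2) u2)).
by move=> x _; rewrite sqM.
Qed.

Lemma L2N u : L2 u -> L2 (fun x => - u x).
Proof. by move=> /(L2Z (-1)); under eq_fun do rewrite mulN1r. Qed.

Lemma L2B u v : L2 u -> L2 v -> L2 (fun x => u x - v x).
Proof. by move=> u2 v2; apply: L2D => //; exact: L2N. Qed.

Lemma L2_conj u : L2 u -> L2 (fun x => (u x)^*%C).
Proof.
by move=> /L2P[u1 u2]; apply: (L2_le (cmeas_conj u1) u2) => x _; rewrite sq_conj.
Qed.

Lemma re_sqM u v x : re (fun x => u x * v x) x ^+ 2 <= sq u x * sq v x.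
Proof. by rewrite -sqM [leRHS]sqE lerDl sqr_ge0. Qed.

Lemma im_sqM u v x : im (fun x => u x * v x) x ^+ 2 <= sq u x * sq v x.
Proof. by rewrite -sqM [leRHS]sqE lerDr sqr_ge0. Qed.

Lemma L2M u v : L2 u -> L2 v -> cL1 (fun x => u x * v x).
Proof.
move=> /L2P[u1 u2] /L2P[v1 v2]; have [m1 m2] := cmeasM u1 v1; split.
- by apply: (L1_CS u2 v2 m1) => // x _; exact: re_sqM.
- by apply: (L1_CS u2 v2 m2) => // x _; exact: im_sqM.
Qed.

(** The factor 2 comes from estimating real and imaginary parts separately; only boundedness matters
    later. *)
Lemma cint_CS u v : L2 u -> L2 v ->
  Normc.normc (cint (fun x => u x * v x)) ^+ 2 <= 2 * (sqnorm u * sqnorm v).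
Proof.
move=> u2 v2; have [L1r L1i] := L2M u2 v2.
have [m1 m2] := cmeasM (L2_meas u2) (L2_meas v2).
rewrite normc_sqr mulr_natl /=.
have H (h : R -> R) : L1 h -> (rint (fun x => `|h x|)) ^+ 2 <= sqnorm u * sqnorm v -> rint h ^+ 2 <= sqnorm u * sqnorm v.
  move=> h1; apply: le_trans; rewrite -[leLHS]real_normK ?num_real //.
  by rewrite lerXn2r ?nnegrE // ?le_norm_rint // (le_trans _ (le_norm_rint h1)).
rewrite mulr2n; apply: lerD; apply: H => //; apply: rint_CS => //; try exact: L2_sq.
- by move=> x _; exact: re_sqM.
- by move=> x _; exact: im_sqM.
Qed.

Lemma cprim_CS u v x : L2 u -> L2 v ->
  Normc.normc (cprim (fun x => u x * v x) x) ^+ 2 <= 2 * (sqnorm u * sqnorm v).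
Proof.
move=> u2 v2; have [L1r L1i] := L2M u2 v2.
have [m1 m2] := cmeasM (L2_meas u2) (L2_meas v2).
rewrite normc_sqr mulr_natl /=.
have H (h : R -> R) : L1 h -> (rint (fun x => `|h x|)) ^+ 2 <= sqnorm u * sqnorm v -> prim h x ^+ 2 <= sqnorm u * sqnorm v.
  move=> h1; apply: le_trans; rewrite -[leLHS]real_normK ?num_real //.
  by rewrite lerXn2r ?nnegrE // ?le_norm_prim // (le_trans _ (le_norm_prim x h1)).
rewrite mulr2n; apply: lerD; apply: H => //; apply: rint_CS => //; try exact: L2_sq.
- by move=> y _; exact: re_sqM.
- by move=> y _; exact: im_sqM.
Qed.

Lemma le_sqnorm u (g : R -> R) : L2 u -> L1 g -> (forall x : R, 0 < x -> sq u x <= g x) -> sqnorm u <= rint g.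
Proof.
move=> u2 g1 ug; apply: le_Rintegral => //; [exact: mRplus|exact: L2_sq|].
by move=> x /Rplus_gt0; exact: ug.
Qed.

Lemma sqnorm_D u v : L2 u -> L2 v -> sqnorm (fun x => u x + v x) <= 2 * sqnorm u + 2 * sqnorm v.
Proof.
move=> u2 v2; have := L2_sq u2; have := L2_sq v2 => v1 u1.
rewrite /sqnorm -(rintZ _ u1) -(rintZ _ v1) -rintD; [|exact: L1Z..].
apply: le_sqnorm; [exact: L2D|by apply: L1D; exact: L1Z|].
by move=> x _; exact: sqD.
Qed.

Lemma sqnorm_Z c u : L2 u -> sqnorm (fun x => c * u x) = Normc.normc c ^+ 2 * sqnorm u.
Proof.
move=> /L2_sq u1; rewrite /sqnorm -rintZ //.
by apply: eq_Rintegral => x _; rewrite sqM.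
Qed.

Lemma sqnorm_N u : sqnorm (fun x => - u x) = sqnorm u.
Proof. by apply: eq_Rintegral => x _; rewrite sqN. Qed.

Lemma sqnorm_B u v : L2 u -> L2 v -> sqnorm (fun x => u x - v x) <= 2 * sqnorm u + 2 * sqnorm v.
Proof. by move=> u2 v2; rewrite -(sqnorm_N v); apply: sqnorm_D => //; exact: L2N. Qed.

Lemma sq_eq0 u x : sq u x = 0 -> u x = 0.
Proof. by move=> /eqP; rewrite sqrf_eq0 => /eqP /Normc.eq0_normc. Qed.

Lemma sqnorm_eq0 u : L2 u -> sqnorm u = 0 -> u = (fun=> 0) %[ae mu in Rplus].
Proof.
move=> /L2_sq u1 u0.
have : ae_eq mu Rplus (EFin \o sq u) (cst 0%E).
  apply/ae_eq_integral_abs; [exact: mRplus|by case/integrableP: u1|].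
  rewrite (_ : 0%E = (sqnorm u)%:E); last by rewrite u0.
  rewrite /sqnorm /rint /Rintegral fineK; last by apply: integrable_fin_num => //; exact: mRplus.
  by apply: eq_integral => x _ /=; rewrite ger0_norm.
by apply: ae_imp => x + xR => /(_ xR)[] /sq_eq0.
Qed.

(** Three zones: near 0 the limit bounds f by |l| + 1, on a compact interval the extreme value
    theorem applies, and beyond it f vanishes. *)
Lemma bounded_supp (f : R -> R) (l : R) : (forall x : R, 0 < x -> {for x, continuous f}) ->
  f x @[x --> (0:R)^'+] --> l -> (\forall x \near +oo, f x = 0) ->
  exists K M : R, 0 < M /\ forall x : R, 0 < x -> `|f x| <= K * (\1_(`]0, M[%classic : set R) x).
Proof.
move=> cf fl [M [_ fM]].
have : \forall x \near (0:R)^'+, `|f x - l| <= 1.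
  by move/cvgrPdist_le : fl => /(_ 1 ltr01); apply: filterS => x; rewrite distrC.
move=> [d /= d0 fd].
(* Past M for the support, and past d so that [d / 2, b] is a genuine interval. *)
pose b := Num.max (M + 1) (d + 1).
have db : d / 2 <= b by rewrite /b le_max; apply/orP; right; lra.
have cw : {within `[d / 2, b], continuous (fun x => `|f x|)}.
  apply: continuous_in_subspaceT => x /set_mem /=; rewrite in_itv /= => /andP[dx _].
  by apply: continuous_comp; [apply: cf; lra|exact: norm_continuous].
have [c _ Hc] := EVT_max db cw.
exists (`|f c| + `|l| + 1), b; split; first by lra.
move=> x x0; rewrite indicE; case: (ltP x b) => xb; last first.
  rewrite fM ?normr0 ?mulr_ge0 ?ler0n ?addr_ge0 //.
  by apply: lt_le_trans xb; rewrite /b lt_max; apply/orP; left; lra.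
rewrite mem_set /=; last by rewrite in_itv /= x0.
rewrite mulr1; case: (ltP x (d / 2)) => xd.
  have : `|f x - l| <= 1.
    by apply: fd => //=; rewrite sub0r normrN gtr0_norm //; lra.
  have := ler_normD (f x - l) l; rewrite subrK.
  by have := normr_ge0 (f c); lra.
have : `|f x| <= `|f c| by apply: Hc; rewrite in_itv /= xd ltW.
by have := normr_ge0 l; lra.
Qed.

(** The definition of [A00] asks only the image to be in L^2; this puts the function itself
    there. *)
Lemma L2_bounded_supp u l : (forall x : R, 0 < x -> ccont u x) -> clim (0^'+) u l ->
  (\forall x \near +oo, u x = 0) -> L2 u.
Proof.
move=> cu [l1 l2] u0.
have [K1 [M1 [M10 H1]]] : exists K M : R, 0 < M /\ forall x : R, 0 < x -> `|re u x| <= K * (\1_(`]0, M[%classic : set R) x).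
  apply: bounded_supp l1 _ => [x x0|]; first by have [] := cu x x0.
  by apply: filterS u0 => x; rewrite /re => ->.
have [K2 [M2 [M20 H2]]] : exists K M : R, 0 < M /\ forall x : R, 0 < x -> `|im u x| <= K * (\1_(`]0, M[%classic : set R) x).
  apply: bounded_supp l2 _ => [x x0|]; first by have [] := cu x x0.
  by apply: filterS u0 => x; rewrite /im => ->.
have I1 (M : R) : L1 (\1_(`]0, M[%classic : set R) : R -> R).
  by apply: integrableS (integrable_indic_itv 0 M false true) => //; exact: mRplus.
apply: (L2_le (cmeas_ccont cu) (rintegrableD mRplus
   (rintegrableZ mRplus (K1 ^+ 2) (I1 M1)) (rintegrableZ mRplus (K2 ^+ 2) (I1 M2)))).
have ind (M x : R) : (\1_(`]0, M[%classic : set R) x : R) = (\1_(`]0, M[%classic : set R) x) ^+ 2.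
  by rewrite indicE; case: (_ \in _); rewrite ?expr1n ?expr0n.
move=> x x0; rewrite sqE; apply: lerD.
- rewrite (ind M1) -exprMn -[leLHS]real_normK ?num_real //.
  by rewrite lerXn2r ?nnegrE // ?H1 // (le_trans _ (H1 x x0)).
- rewrite (ind M2) -exprMn -[leLHS]real_normK ?num_real //.
  by rewrite lerXn2r ?nnegrE // ?H2 // (le_trans _ (H2 x x0)).
Qed.

End L2.

(** * Quasi-derivatives *)

Section Smoothness.
Context {R : realType}.
Implicit Types (f g : R -> R) (u : R -> R[i]).

(** The given derivatives agree with [derive1] only for positive arguments, so each identification
    is made on a neighbourhood before differentiating again. *)
Lemma Cn2_intro f f1 f2 :
  (forall x : R, 0 < x -> is_derive x 1 f (f1 x)) ->
  (forall x : R, 0 < x -> is_derive x 1 f1 (f2 x)) ->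
  (forall x : R, 0 < x -> {for x, continuous f2}) -> Cn 2 f.
Proof.
move=> d1 d2 c2.
have E1 (x : R) : 0 < x -> \forall y \near x, f1 y = derive1 f y.
  move=> x0; have : \forall y \near x, 0 < y by exact: lt_nbhsr.
  apply: filterS => y y0; rewrite derive1E.
  by rewrite (@derive_val _ _ _ _ _ _ _ (d1 y y0)).
have D1 (x : R) : 0 < x -> is_derive x 1 (derive1 f) (f2 x).
  by move=> x0; apply: near_eq_is_derive (d2 x x0); rewrite ?oner_eq0 //; exact: E1.
have E2 (x : R) : 0 < x -> \forall y \near x, f2 y = derive1 (derive1 f) y.
  move=> x0; have : \forall y \near x, 0 < y by exact: lt_nbhsr.
  apply: filterS => y y0; rewrite [RHS]derive1E.
  by rewrite (@derive_val _ _ _ _ _ _ _ (D1 y y0)).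
split=> [[|[|//]] _ x x0|x x0].
- by have [] := d1 x x0.
- by rewrite derive1n1; have [] := D1 x x0.
- rewrite derive1nS derive1n1 /prop_for /continuous_at.
  rewrite -(nbhs_singleton (E2 x x0)).
  apply: (cvg_trans _ (c2 x x0)); apply: near_eq_cvg; exact: E2.
Qed.

Lemma Cn2_elim f : Cn 2 f -> forall x : R, 0 < x ->
  [/\ is_derive x 1 f (derive1 f x), is_derive x 1 (derive1 f) (derive1n 2 f x) &
      {for x, continuous (derive1n 2 f)}].
Proof.
move=> [d c] x x0; split; last exact: c.
- by rewrite derive1E; apply/derivableP; exact: (d 0 _ x x0).
- by rewrite derive1nS derive1n1 derive1E; apply/derivableP; exact: (d 1 _ x x0).
Qed.

Lemma re_cderiv u : re (cderiv u) = derive1 (re u). Proof. by []. Qed.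
Lemma im_cderiv u : im (cderiv u) = derive1 (im u). Proof. by []. Qed.

Lemma re_cderiv2 u : re (cderiv (cderiv u)) = derive1n 2 (re u).
Proof. by rewrite (re_cderiv (cderiv u)) (re_cderiv u) derive1nS derive1n1. Qed.

Lemma im_cderiv2 u : im (cderiv (cderiv u)) = derive1n 2 (im u).
Proof. by rewrite (im_cderiv (cderiv u)) (im_cderiv u) derive1nS derive1n1. Qed.

Lemma cder_parts u (x a b : R) : is_derive x 1 (re u) a -> is_derive x 1 (im u) b ->
  cder u x (a +i* b).
Proof. by split. Qed.

Lemma ccont_parts u (x : R) : {for x, continuous (re u)} -> {for x, continuous (im u)} ->
  ccont u x.
Proof. by split. Qed.

Lemma cCn2_cder u : cCn 2 u -> forall x : R, 0 < x ->
  cder u x (cderiv u x) /\ cder (cderiv u) x (cderiv (cderiv u) x).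
Proof.
move=> [/Cn2_elim r2 /Cn2_elim i2] x x0.
have [r0 r1 _] := r2 x x0; have [i0 i1 _] := i2 x x0.
have H : cder (cderiv u) x (derive1n 2 (re u) x +i* derive1n 2 (im u) x).
  by apply: cder_parts; rewrite ?re_cderiv ?im_cderiv.
by split; [exact: cder_parts r0 i0|rewrite (cder_cderiv H)].
Qed.

Lemma cCn2_ccont u : cCn 2 u -> forall x : R, 0 < x -> ccont (cderiv (cderiv u)) x.
Proof.
move=> [/Cn2_elim r2 /Cn2_elim i2] x x0.
have [_ _ c1] := r2 x x0; have [_ _ c2] := i2 x x0.
by apply: ccont_parts; [rewrite re_cderiv2; exact: c1|rewrite im_cderiv2; exact: c2].
Qed.

Lemma cCn2_intro u u1 u2 :
  (forall x : R, 0 < x -> cder u x (u1 x)) ->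
  (forall x : R, 0 < x -> cder u1 x (u2 x)) ->
  (forall x : R, 0 < x -> ccont u2 x) -> cCn 2 u.
Proof.
move=> d1 d2 c; split.
- by apply: (@Cn2_intro _ (re u1) (re u2)) => x x0;
    [have [] := d1 x x0|have [] := d2 x x0|have [] := c x x0].
- by apply: (@Cn2_intro _ (im u1) (im u2)) => x x0;
    [have [] := d1 x x0|have [] := d2 x x0|have [] := c x x0].
Qed.

Lemma cCn2_real_mul f u : Cn 2 f -> cCn 2 u -> cCn 2 (fun x => (f x)%:C * u x).
Proof.
move=> /Cn2_elim f2 u2.
apply: (@cCn2_intro _ (fun x => (derive1 f x)%:C * u x + (f x)%:C * cderiv u x)
  (fun x => ((derive1n 2 f x)%:C * u x + (derive1 f x)%:C * cderiv u x) +
            ((derive1 f x)%:C * cderiv u x + (f x)%:C * cderiv (cderiv u) x))) => x x0;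
  have [df ddf cf] := f2 x x0; have [du ddu] := cCn2_cder u2 x0.
- by apply: cderM => //; exact: cder_real.
- by apply: cderD; apply: cderM => //; exact: cder_real.
- have cu := cder_ccont du; have cdu := cder_ccont ddu.
  have cf0 := cder_ccont (cder_real df); have cf1 := cder_ccont (cder_real ddf).
  have cf2 : ccont (fun x => (derive1n 2 f x)%:C) x by exact: clim_real.
  exact: (climD (climD (climM cf2 cu) (climM cf1 cdu))
               (climD (climM cf1 cdu) (climM cf0 (cCn2_ccont u2 x0)))).
Qed.

Lemma cderiv_near u v (x : R) : (\forall y \near x, u y = v y) -> cderiv u x = cderiv v x.
Proof.
move=> uv; rewrite /cderiv !derive1E; congr (_ +i* _).
- by apply: near_eq_derive; rewrite ?oner_eq0 //; apply: filterS uv => y E; rewrite /re E.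
- by apply: near_eq_derive; rewrite ?oner_eq0 //; apply: filterS uv => y E; rewrite /im E.
Qed.

Lemma cder0_cst u l : (forall x : R, 0 < x -> cder u x 0) -> clim (0^'+) u l ->
  forall x : R, 0 < x -> u x = l.
Proof.
move=> du ul x x0.
have /eqP : cprim (fun=> 0) x = u x - l.
  by apply: (@cprim_primitive _ (fun=> 0) _ _ _ x0 _ _ du ul) => [|y _];
    [exact: cintegrable0|exact: clim_cst].
rewrite (_ : cprim _ x = 0); first by rewrite eq_sym subr_eq0 => /eqP.
by rewrite cprim_parts /prim; congr (_ +i* _); rewrite /Rintegral integral0.
Qed.

End Smoothness.

Section QuasiDerivative.
Context {R : realType} (p q : R -> R) (p0 : R).
Hypotheses (p_C1 : Cn 1 p) (q_C0 : Cn 0 q) (p_gt0 : forall x : R, 0 < x -> 0 < p x).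
Hypotheses (p_lim0 : p x @[x --> 0^'+] --> p0).
Implicit Types (u v w g : R -> R[i]) (x : R) (z : R[i]).

(* On R_+, w = p u' and calA p q u = g. *)
Definition QD u w g := forall x, 0 < x ->
  cder u x ((p x)^-1%:C * w x) /\ cder w x ((q x)%:C * u x - g x).

Lemma p_mulV x : 0 < x -> (p x)%:C * (p x)^-1%:C = 1.
Proof. by move=> x0; rewrite -rmorphM /= mulfV ?gt_eqF ?p_gt0. Qed.

Lemma QD_eq u w g g' : (forall x, 0 < x -> g x = g' x) -> QD u w g -> QD u w g'.
Proof. by move=> gg H x x0; rewrite -gg //; exact: H. Qed.

Lemma QD_conj u w g : QD u w g ->
  QD (fun x => (u x)^*%C) (fun x => (w x)^*%C) (fun x => (g x)^*%C).
Proof.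
move=> H x x0; have [d1 d2] := H x x0.
split; [apply: cder_eq (cder_conj d1) _|apply: cder_eq (cder_conj d2) _].
- by rewrite conjcM conjc_real.
- by rewrite conjcB conjcM conjc_real.
Qed.

(** Lagrange's identity: the products of quasi-derivatives and the terms in q cancel. *)
Lemma QD_wronskian u w g v y h : QD u w g -> QD v y h -> forall x, 0 < x ->
  cder (fun x => w x * v x - u x * y x) x (u x * h x - g x * v x).
Proof.
move=> H1 H2 x x0; have [u1 w1] := H1 x x0; have [v1 y1] := H2 x x0.
apply: cder_eq (cderB (cderM w1 v1) (cderM u1 y1)) _.
ring.
Qed.

Lemma QD_ccont u w g x : QD u w g -> 0 < x -> ccont u x /\ ccont w x.
Proof. by move=> H x0; have [/cder_ccont ? /cder_ccont] := H x x0. Qed.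

Lemma p_cder x : 0 < x -> cder (fun x => (p x)%:C) x (derive1 p x)%:C.
Proof.
move=> x0; apply: cder_real; rewrite derive1E; apply/derivableP.
exact: (p_C1.1 0 _ x x0).
Qed.

Lemma p_ccont x : 0 < x -> ccont (fun x => (p x)%:C) x.
Proof. by move=> /p_cder; exact: cder_ccont. Qed.

Lemma dp_ccont x : 0 < x -> ccont (fun x => (derive1 p x)%:C) x.
Proof. by move=> x0; apply: clim_real; exact: (p_C1.2 x x0). Qed.

Lemma q_ccont x : 0 < x -> ccont (fun x => (q x)%:C) x.
Proof. by move=> x0; apply: clim_real; exact: (q_C0.2 x x0). Qed.

Lemma pV_cder x : 0 < x -> cder (fun x => (p x)^-1%:C) x (- (p x ^- 2 * derive1 p x))%:C.
Proof.
move=> x0; have px0 : p x != 0 by rewrite gt_eqF ?p_gt0.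
apply: cder_real.
have dp : is_derive x 1 p (derive1 p x).
  by rewrite derive1E; apply/derivableP; exact: (p_C1.1 0 _ x x0).
have := is_deriveV px0 dp.
by rewrite /GRing.scale /= mulNr.
Qed.

Lemma pV_ccont x : 0 < x -> ccont (fun x => (p x)^-1%:C) x.
Proof. by move=> /pV_cder; exact: cder_ccont. Qed.

Lemma cCn2_QD u : cCn 2 u -> QD u (fun x => (p x)%:C * cderiv u x) (calA p q u).
Proof.
move=> u2 x x0; have [d1 d2] := cCn2_cder u2 x0; split.
  by rewrite mulrA [_%:C * _]mulrC p_mulV // mul1r.
apply: cder_eq (cderM (p_cder x0) d2) _; rewrite /calA.
by rewrite (cder_cderiv (cderM (p_cder x0) d2)); ring.
Qed.

Lemma calA_ccont u x : cCn 2 u -> 0 < x -> ccont (calA p q u) x.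
Proof.
move=> u2 x0.
pose F y := - ((derive1 p y)%:C * cderiv u y + (p y)%:C * cderiv (cderiv u) y) + (q y)%:C * u y.
have FE y : 0 < y -> F y = calA p q u y.
  move=> y0; have [d1 d2] := cCn2_cder u2 y0.
  by rewrite /F /calA (cder_cderiv (cderM (p_cder y0) d2)).
have [d1 d2] := cCn2_cder u2 x0.
have cF : ccont F x.
  apply: climD.
    apply: climN; apply: climD; apply: climM.
    - exact: dp_ccont. - exact: cder_ccont d2. - exact: p_ccont. - exact: cCn2_ccont.
  by apply: climM; [exact: q_ccont|exact: cder_ccont d1].
rewrite -FE //; apply: clim_near cF.
by have : \forall y \near x, 0 < y by [exact: lt_nbhsr]; apply: filterS => y; exact: FE.
Qed.

(** u' = w / p is a quotient of differentiable functions. This gives the Green operator values of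
    class C^2, as [A00] demands. *)
Lemma QD_cCn2 u w g : QD u w g -> (forall x, 0 < x -> ccont g x) -> cCn 2 u.
Proof.
move=> H cg.
apply: (@cCn2_intro _ u (fun x => (p x)^-1%:C * w x)
  (fun x => (- (p x ^- 2 * derive1 p x))%:C * w x + (p x)^-1%:C * ((q x)%:C * u x - g x))) => x x0.
- by have [] := H x x0.
- by apply: cderM; [exact: pV_cder|have [] := H x x0].
- have [cu cw] := QD_ccont H x0.
  apply: climD; apply: climM => //.
  + apply: clim_real; apply: cvgN; apply: cvgM; last exact: (p_C1.2 x x0).
    have px0 : p x ^+ 2 != 0 by rewrite expf_neq0 // gt_eqF ?p_gt0.
    apply: cvgV => //; apply: cvgM; by have [] := p_ccont x0.
  + exact: pV_ccont.
  + by apply: climB; [apply: climM => //; exact: q_ccont|exact: cg].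
Qed.

Lemma QD_cderiv u w g x : QD u w g -> 0 < x ->
  cderiv u x = (p x)^-1%:C * w x /\ calA p q u x = g x.
Proof.
move=> H x0; have E y : 0 < y -> cderiv u y = (p y)^-1%:C * w y.
  by move=> y0; have [/cder_cderiv] := H y y0.
split; first exact: E.
rewrite /calA (@cderiv_near _ _ w); last first.
  have : \forall y \near x, 0 < y by exact: lt_nbhsr.
  by apply: filterS => y y0; rewrite E // mulrA p_mulV // mul1r.
have [_ /cder_cderiv ->] := H x x0; ring.
Qed.

Lemma calA_near u v x : (\forall y \near x, u y = v y) -> calA p q u x = calA p q v x.
Proof.
move=> uv; have E : u x = v x := nbhs_singleton uv.
rewrite /calA E.
suff -> : cderiv (fun y => (p y)%:C * cderiv u y) x = cderiv (fun y => (p y)%:C * cderiv v y) x by [].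
by apply: cderiv_near; apply: filterS (near_join uv) => y /cderiv_near ->.
Qed.

Lemma solution_QD z u : solution p q z u ->
  QD u (fun x => (p x)%:C * cderiv u x) (fun x => z * u x).
Proof. by move=> [u2 E]; apply: QD_eq (cCn2_QD u2). Qed.

Lemma boundary_quasi u b : boundary_values u b ->
  clim (0^'+) u b.1 /\ clim (0^'+) (fun x => (p x)%:C * cderiv u x) (p0%:C * b.2).
Proof. by move=> [b1 b2]; split=> //; apply: climM => //; exact: clim_real. Qed.

End QuasiDerivative.

(** * Rules for complex integrals on the half-line *)

Section Extra.
Context {R : realType}.
Notation mu := (@lebesgue_measure R).
Notation Rplus := (@Rplus R).
Implicit Types (u v : R -> R[i]) (x : R).

Lemma cae_eq0 u : (forall x, 0 < x -> ccont u x) ->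
  {ae mu, forall x, 0 < x -> u x = 0} -> forall x, 0 < x -> u x = 0.
Proof.
move=> cu u0 x x0; apply: complex_ext => /=.
- apply: (@ae_continuous_eq0 _ (re u)) x x0 => [x x0|]; first by have [] := cu x x0.
  by apply: ae_imp u0 => x + x0 => /(_ x0); rewrite /re => ->.
- apply: (@ae_continuous_eq0 _ (im u)) x x0 => [x x0|]; first by have [] := cu x x0.
  by apply: ae_imp u0 => x + x0 => /(_ x0); rewrite /im => ->.
Qed.

Lemma cintB u v : cL1 u -> cL1 v -> cint (fun x => u x - v x) = cint u - cint v.
Proof. exact: (cintegralB mRplus). Qed.
Lemma cintD u v : cL1 u -> cL1 v -> cint (fun x => u x + v x) = cint u + cint v.
Proof. exact: (cintegralD mRplus). Qed.
Lemma cintZ k u : cL1 u -> cint (fun x => k * u x) = k * cint u.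
Proof. exact: (cintegralZ mRplus). Qed.
Lemma cL1D u v : cL1 u -> cL1 v -> cL1 (fun x => u x + v x).
Proof. exact: (cintegrableD mRplus). Qed.
Lemma cL1B u v : cL1 u -> cL1 v -> cL1 (fun x => u x - v x).
Proof. exact: (cintegrableB mRplus). Qed.
Lemma cL1Z k u : cL1 u -> cL1 (fun x => k * u x).
Proof. exact: (cintegrableZ mRplus). Qed.
Lemma cprimD u v x : cL1 u -> cL1 v -> cprim (fun x => u x + v x) x = cprim u x + cprim v x.
Proof. by move=> u1 v1; apply: cintegralD; [exact: measurable_itv|exact: cL1_itv..]. Qed.
Lemma cprimZ k u x : cL1 u -> cprim (fun x => k * u x) x = k * cprim u x.
Proof. by move=> u1; apply: cintegralZ; [exact: measurable_itv|exact: cL1_itv]. Qed.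
Lemma eq_cint u v : (forall x, 0 < x -> u x = v x) -> cint u = cint v.
Proof. by move=> uv; apply: eq_cintegral => x /Rplus_gt0; exact: uv. Qed.
Lemma eq_cL1 u v : (forall x, 0 < x -> u x = v x) -> cL1 u -> cL1 v.
Proof. by move=> uv; apply: (eq_cintegrable mRplus) => x /Rplus_gt0; exact: uv. Qed.
Lemma eq_cprim u v x : (forall x, 0 < x -> u x = v x) -> cprim u x = cprim v x.
Proof. by move=> uv; apply: eq_cintegral => y; rewrite /= in_itv /= => /andP[+ _]; exact: uv. Qed.
Lemma ae_eq_cint u v : cL1 u -> cL1 v -> u = v %[ae mu in Rplus] -> cint u = cint v.
Proof. exact: (ae_eq_cintegral mRplus). Qed.
Lemma ae_eq_cprim u v x : cL1 u -> cL1 v -> u = v %[ae mu in Rplus] -> cprim u x = cprim v x.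
Proof.
move=> u1 v1 uv; apply: ae_eq_cintegral; [exact: measurable_itv|exact: cL1_itv..|].
by apply: ae_imp uv => y + yx; apply; exact: (@sub_Rplus _ x true).
Qed.

(** Turns Green's formula up to a point into one on the whole half-line, by comparison with a
    function that has the same tail. *)
Lemma cint_tail u v x : 0 < x -> cL1 u -> cL1 v -> (forall y, x < y -> u y = v y) ->
  cint u - cprim u x = cint v - cprim v x.
Proof.
move=> x0 u1 v1 uv; rewrite -!cint_split //; apply: eq_cintegral => y.
by rewrite /= in_itv /= andbT; exact: uv.
Qed.

Lemma sq_le2 (a b : R[i]) (k l : R) : Normc.normc a ^+ 2 <= k -> Normc.normc b ^+ 2 <= l ->
  Normc.normc (a - b) ^+ 2 <= 2 * k + 2 * l.
Proof.
move=> ak bl; have := @sqD R (fun=> a) (fun=> - b) 0.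
rewrite /sq => H; apply: (le_trans H); rewrite -[Normc.normc (- b)]/(Normc.normc (- b)).
have -> : Normc.normc (- b) ^+ 2 = Normc.normc b ^+ 2 by exact: (@sqN R (fun=> b) 0).
lra.
Qed.

End Extra.

(** * Fundamental pairs and the Green operator *)

Section Green.
Context {R : realType} (p q : R -> R).
Hypothesis (p_gt0 : forall x : R, 0 < x -> 0 < p x).
Notation mu := (@lebesgue_measure R).
Notation Rplus := (@Rplus R).
Notation QD := (QD p q).
Implicit Types (f t u v w g h k m : R -> R[i]) (x : R).

(* f and t stand for phi_z and theta_z, and wf and wt for their quasi-derivatives. *)
Record fundamental (z : R[i]) f wf t wt (a b c d : R[i]) : Prop := Fundamental {
  fund_f : QD f wf (fun x => z * f x);
  fund_t : QD t wt (fun x => z * t x);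
  fund_f0 : clim (0^'+) f a;
  fund_wf0 : clim (0^'+) wf b;
  fund_t0 : clim (0^'+) t c;
  fund_wt0 : clim (0^'+) wt d;
  fund_det : b * c - a * d = 1;
  fund_f2 : L2 f;
  fund_t2 : L2 t }.

(* On R_+, this is calR phi theta z h when f and t are phi_z and theta_z. *)
Definition green f t h : R -> R[i] := fun x =>
  t x * cprim (fun y => f y * h y) x +
  f x * (cint (fun y => t y * h y) - cprim (fun y => t y * h y) x).

Lemma green_D f t h k x : L2 f -> L2 t -> L2 h -> L2 k ->
  green f t (fun x => h x + k x) x = green f t h x + green f t k x.
Proof.
move=> f2 t2 h2 k2; rewrite /green.
have E u : (fun y => u y * (h y + k y)) = fun y => u y * h y + u y * k y.
  by apply/funext => y; rewrite mulrDr.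
rewrite !E !cprimD ?cintD; try exact: L2M.
by ring.
Qed.

Lemma green_Z f t e h x : L2 f -> L2 t -> L2 h ->
  green f t (fun x => e * h x) x = e * green f t h x.
Proof.
move=> f2 t2 h2; rewrite /green.
have E u : (fun y => u y * (e * h y)) = fun y => e * (u y * h y).
  by apply/funext => y; ring.
rewrite !E !cprimZ ?cintZ; try exact: L2M.
by ring.
Qed.

Lemma green_ae f t h k x : L2 f -> L2 t -> L2 h -> L2 k ->
  h = k %[ae mu in Rplus] -> green f t h x = green f t k x.
Proof.
move=> f2 t2 h2 k2 hk.
have E u : (fun y => u y * h y) = (fun y => u y * k y) %[ae mu in Rplus].
  by apply: ae_imp hk => y + yR => /(_ yR) ->.
by rewrite /green !(ae_eq_cprim x (L2M _ h2) (L2M _ k2) (E _)) // (ae_eq_cint (L2M t2 h2) (L2M t2 k2) (E _)).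
Qed.

Lemma green_eq f t h k x : (forall x, 0 < x -> h x = k x) -> green f t h x = green f t k x.
Proof.
move=> hk; rewrite /green.
have E u y : 0 < y -> u y * h y = u y * k y by move=> y0; rewrite hk.
by rewrite (eq_cprim x (E f)) (eq_cprim x (E t)) (eq_cint (E t)).
Qed.

Section Pair.
Context (z : R[i]) (f wf t wt : R -> R[i]) (a b c d : R[i]).
Hypothesis (F : fundamental z f wf t wt a b c d).
Let f2 := fund_f2 F.
Let t2 := fund_t2 F.
Notation S := (green f t).

(** Constant by Lagrange's identity, and equal to 1 by the initial values. *)
Lemma fund_wronskian x : 0 < x -> wf x * t x - f x * wt x = 1.
Proof.
rewrite -(fund_det F); move: x.
apply: (@cder0_cst _ (fun x => wf x * t x - f x * wt x)) => [x x0|].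
  by apply: cder_eq (QD_wronskian (fund_f F) (fund_t F) x0) _; ring.
apply: climB; apply: climM;
  [exact: (fund_wf0 F)|exact: (fund_t0 F)|exact: (fund_f0 F)|exact: (fund_wt0 F)].
Qed.

(** The quasi-derivative of [green f t h]: the terms that differentiate the two integrals are t f h
    and - f t h, and cancel. *)
Definition greenw h : R -> R[i] := fun x =>
  wt x * cprim (fun y => f y * h y) x +
  wf x * (cint (fun y => t y * h y) - cprim (fun y => t y * h y) x).

Lemma tail_cder k x : 0 < x -> cL1 k -> cder (cprim k) x (k x) ->
  cder (fun x => cint k - cprim k x) x (- k x).
Proof.
by move=> x0 k1 dk; apply: cder_eq (cderB (cder_cst (cint k) x) dk) _; rewrite sub0r.
Qed.

Lemma tail_ccont k x : 0 < x -> cL1 k -> ccont (fun x => cint k - cprim k x) x.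
Proof. by move=> x0 k1; apply: climB; [exact: clim_cst|exact: cprim_ccont]. Qed.

Lemma green_ccont h x : L2 h -> 0 < x -> ccont (S h) x.
Proof.
move=> h2 x0; have [cf _] := QD_ccont (fund_f F) x0; have [ct _] := QD_ccont (fund_t F) x0.
by apply: climD; apply: climM => //; [apply: cprim_ccont => //; exact: L2M|
  apply: tail_ccont => //; exact: L2M].
Qed.

(** Variation of parameters. In the second differentiation the integrals contribute minus the
    Wronskian times h, that is -h. *)
Lemma green_QD h : L2 h -> (forall x, 0 < x -> ccont h x) ->
  QD (S h) (greenw h) (fun x => h x + z * S h x).
Proof.
move=> h2 ch x x0.
have [df dwf] := fund_f F x0; have [dt dwt] := fund_t F x0.
have fh1 := L2M f2 h2; have th1 := L2M t2 h2.
have dA : cder (cprim (fun y => f y * h y)) x (f x * h x).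
  by apply: cprim_cder => //; apply: climM; [exact: cder_ccont df|exact: ch].
have dB : cder (cprim (fun y => t y * h y)) x (t x * h x).
  by apply: cprim_cder => //; apply: climM; [exact: cder_ccont dt|exact: ch].
have {}dB := tail_cder x0 th1 dB.
have W := fund_wronskian x0; split.
- apply: cder_eq (cderD (cderM dt dA) (cderM df dB)) _; rewrite /greenw.
  by ring.
- apply: cder_eq (cderD (cderM dwt dA) (cderM dwf dB)) _; rewrite /green.
  rewrite -[in RHS](mul1r (h x)) -W; ring.
Qed.

Lemma tail_lim k : cL1 k -> clim (0^'+) (fun x => cint k - cprim k x) (cint k).
Proof.
by move=> k1; rewrite -[X in clim _ _ X]subr0; apply: climB; [exact: clim_cst|exact: cprim_lim0].
Qed.

(** At 0 the primitives vanish, so S h and its quasi-derivative have the boundary values of (t, h) f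
    and inherit the boundary condition of f. *)
Lemma green_lim0 h : L2 h -> clim (0^'+) (S h) (a * cint (fun y => t y * h y)).
Proof.
move=> h2; rewrite -[X in clim _ _ X]add0r -[X in X + _](mulr0 c).
apply: climD; apply: climM; [exact: (fund_t0 F)|apply: cprim_lim0; exact: L2M|exact: (fund_f0 F)|].
by apply: tail_lim; exact: L2M.
Qed.

Lemma greenw_lim0 h : L2 h -> clim (0^'+) (greenw h) (b * cint (fun y => t y * h y)).
Proof.
move=> h2; rewrite -[X in clim _ _ X]add0r -[X in X + _](mulr0 d).
apply: climD; apply: climM; [exact: (fund_wt0 F)|apply: cprim_lim0; exact: L2M|exact: (fund_wf0 F)|].
by apply: tail_lim; exact: L2M.
Qed.

(** Constants: 4 is the 2 of [sqD] times the 2 of Cauchy-Schwarz; 16 is 2 times 8, where 8 bounds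
    the tail as a difference of two integrals. Their sum is the 20 of [green_sqnorm]. *)
Lemma green_sq h x : L2 h ->
  sq (S h) x <= (4 * (sqnorm f * sqnorm h)) * sq t x + (16 * (sqnorm t * sqnorm h)) * sq f x.
Proof.
move=> h2; apply: (le_trans (sqD _ _ _)); rewrite !sqM.
have A := cprim_CS x f2 h2; have B := sq_le2 (cint_CS t2 h2) (cprim_CS x t2 h2).
rewrite -/(sq (cprim (fun y => f y * h y)) x) in A.
rewrite -/(sq (fun x => cint (fun y => t y * h y) - cprim (fun y => t y * h y) x) x) in B.
have := ler_wpM2l (sq_ge0 t x) A; have := ler_wpM2l (sq_ge0 f x) B.
move: (sq t x) (sq f x) (sq _ x) (sq _ x) (sqnorm f) (sqnorm t) (sqnorm h) => *; nra.
Qed.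

Lemma green_L2 h : L2 h -> L2 (S h).
Proof.
move=> h2; apply: (L2_le _ (L1D (L1Z (4 * (sqnorm f * sqnorm h)) (L2_sq t2)) (L1Z (16 * (sqnorm t * sqnorm h)) (L2_sq f2)))).
- by apply: cmeas_ccont => x; exact: green_ccont.
- by move=> x _; exact: green_sq.
Qed.

Lemma green_sqnorm h : L2 h -> sqnorm (S h) <= 20 * (sqnorm f * sqnorm t) * sqnorm h.
Proof.
move=> h2; apply: (le_trans (le_sqnorm (green_L2 h2)
  (L1D (L1Z (4 * (sqnorm f * sqnorm h)) (L2_sq t2)) (L1Z (16 * (sqnorm t * sqnorm h)) (L2_sq f2))) _)).
  by move=> x _; exact: green_sq.
rewrite rintD ?rintZ; try (exact: L2_sq); try (apply: L1Z; exact: L2_sq).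
by rewrite -/(sqnorm f) -/(sqnorm t); nra.
Qed.

(** The kernel f(min(x, y)) t(max(x, y)) is symmetric. The pairing is bilinear, so this holds for
    complex z without conjugation. *)
Lemma green_sym h k : L2 h -> L2 k ->
  cint (fun x => S h x * k x) = cint (fun x => h x * S k x).
Proof.
move=> h2 k2.
have fh := L2M f2 h2; have th := L2M t2 h2; have fk := L2M f2 k2; have tk := L2M t2 k2.
have T u v : cL1 u -> cL1 v -> cL1 (fun x => u x * (cint v - cprim v x)).
  move=> u1 v1; apply: eq_cL1 (cL1B (cL1Z (cint v) u1) (cL1_mul_prim u1 v1)) => x _.
  by ring.
transitivity (cint (fun x => (t x * k x) * cprim (fun y => f y * h y) x) +
  cint (fun x => (f x * k x) * (cint (fun y => t y * h y) - cprim (fun y => t y * h y) x))).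
  rewrite -cintD; [|exact: cL1_mul_prim|exact: T].
  by apply: eq_cint => x _; rewrite /green; ring.
rewrite (cint_prim_swap fh tk) -(cint_prim_swap fk th) -cintD; [|exact: T|exact: cL1_mul_prim].
by apply: eq_cint => x _; rewrite /green; ring.
Qed.

(** Here k is (A - z) u, and by Lagrange's identity the two Wronskians with u are primitives of f k
    and t k. Eliminating w between them, with Wronskian 1, recovers u. *)
Lemma green_formula u w g k (e1 e2 : R[i]) x : QD u w g ->
  (forall x, 0 < x -> k x = g x - z * u x) ->
  (forall x, 0 < x -> ccont k x) -> L2 k ->
  clim (0^'+) u e1 -> clim (0^'+) w e2 -> 0 < x ->
  [/\ cprim (fun y => f y * k y) x = (wf x * u x - f x * w x) - (b * e1 - a * e2),
      cprim (fun y => t y * k y) x = (wt x * u x - t x * w x) - (d * e1 - c * e2) &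
      S k x = u x + f x * (cint (fun y => t y * k y) + (d * e1 - c * e2)) - t x * (b * e1 - a * e2)].
Proof.
move=> Q kE ck k2 ue we x0.
have E1 : cprim (fun y => f y * k y) x = (wf x * u x - f x * w x) - (b * e1 - a * e2).
  apply: (@cprim_primitive _ _ (fun x => wf x * u x - f x * w x)) => //.
  - exact: L2M.
  - by move=> y y0; apply: climM; [have [] := QD_ccont (fund_f F) y0|exact: ck].
  - move=> y y0; apply: cder_eq (QD_wronskian (fund_f F) Q y0) _.
    by rewrite kE //; ring.
  - apply: climB; apply: climM => //; [exact: (fund_wf0 F)|exact: (fund_f0 F)].
have E2 : cprim (fun y => t y * k y) x = (wt x * u x - t x * w x) - (d * e1 - c * e2).
  apply: (@cprim_primitive _ _ (fun x => wt x * u x - t x * w x)) => //.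
  - exact: L2M.
  - by move=> y y0; apply: climM; [have [] := QD_ccont (fund_t F) y0|exact: ck].
  - move=> y y0; apply: cder_eq (QD_wronskian (fund_t F) Q y0) _.
    by rewrite kE //; ring.
  - apply: climB; apply: climM => //; [exact: (fund_wt0 F)|exact: (fund_t0 F)].
split => //.
rewrite /green E1 E2 -[X in _ = X + _ - _](mulr1) -(fund_wronskian x0); ring.
Qed.

(* Green's formula with k = 0: it replaces a uniqueness theorem for the initial value problem. *)
Lemma fund_repr u w (e1 e2 : R[i]) x : QD u w (fun x => z * u x) ->
  clim (0^'+) u e1 -> clim (0^'+) w e2 -> 0 < x ->
  u x = t x * (b * e1 - a * e2) - f x * (d * e1 - c * e2).
Proof.
move=> Q ue we x0.
have L20 : L2 (fun=> 0 : R[i]).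
  have := L2Z 0 f2; congr L2; apply/funext => y; exact: mul0r.
have [||_ _] := @green_formula u w (fun x => z * u x) (fun=> 0) e1 e2 x Q _ _ L20 ue we x0.
- by move=> y _; rewrite subrr.
- by move=> y _; exact: clim_cst.
have E v : (fun y => v y * (0 : R[i])) = fun=> 0 * (0 : R[i]).
  by apply/funext => y; rewrite !mulr0.
have c0 : cL1 (fun=> 0 : R[i]) by exact: cintegrable0.
rewrite /green !E cprimZ // cintZ // !mul0r !mulr0 subr0 add0r mulr0 add0r => /esym H.
by apply/eqP; rewrite -subr_eq0 -[X in _ == X]H; apply/eqP; ring.
Qed.

(** Write S m + e f = t A + f B with A' = f m and B' = - t m. The derivative of t A + f B = 0 gives
    wt A + wf B = 0 as well, and the determinant 1 forces A = B = 0; differentiating once more gives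
    f m = t m = 0, where f and t have no common zero. *)
Lemma green_inj m e : L2 m ->
  {ae mu, forall x, 0 < x -> S m x + e * f x = 0} -> {ae mu, forall x, 0 < x -> m x = 0}.
Proof.
move=> m2 H.
have fm := L2M f2 m2; have tm := L2M t2 m2.
pose A := cprim (fun y => f y * m y).
pose B x := cint (fun y => t y * m y) - cprim (fun y => t y * m y) x + e.
have cA x : 0 < x -> ccont A x by move=> x0; exact: cprim_ccont.
have cB x : 0 < x -> ccont B x.
  by move=> x0; apply: climD; [exact: tail_ccont|exact: clim_cst].
have H0 x : 0 < x -> t x * A x + f x * B x = 0.
  apply: (@cae_eq0 _ (fun x => t x * A x + f x * B x)) => [y y0|].
    have [cf _] := QD_ccont (fund_f F) y0; have [ct _] := QD_ccont (fund_t F) y0.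
    by apply: climD; apply: climM => //; [exact: cA|exact: cB].
  apply: ae_imp H => y + y0 => /(_ y0) <-; rewrite /green /A /B; ring.
have dA := cprim_cder_ae fm.
have dB : {ae mu, forall x, 0 < x -> cder B x (- (t x * m x))}.
  apply: ae_imp (cprim_cder_ae tm) => x + x0 => /(_ x0) /(tail_cder x0 tm) D.
  by apply: cder_eq (cderD D (cder_cst e x)) _; rewrite addr0.
have AB : {ae mu, forall x, 0 < x -> A x = 0 /\ B x = 0}.
  apply: ae_imp2 dA dB => x DA DB x0; have {}DA := DA x0; have {}DB := DB x0.
  have [df _] := fund_f F x0; have [dt _] := fund_t F x0.
  have D0 : cder (fun x => t x * A x + f x * B x) x 0.
    apply: cder_near (cder_cst 0 x).
    by have : \forall y \near x, 0 < y by [exact: lt_nbhsr]; apply: filterS => y /H0.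
  have D1 := cder_unique (cderD (cderM dt DA) (cderM df DB)) D0.
  have W := fund_wronskian x0; have Z := H0 x x0.
  have pW : wt x * A x + wf x * B x = 0.
    have := congr1 (fun y => (p x)%:C * y) D1; rewrite mulr0 => <-.
    have P := p_mulV p_gt0 x0.
    transitivity (((p x)%:C * (p x)^-1%:C) * (wt x * A x + wf x * B x)); first by rewrite P mul1r.
    by rewrite -/A; ring.
  split.
  - transitivity (wf x * (t x * A x + f x * B x) - f x * (wt x * A x + wf x * B x)).
      by rewrite -[LHS](mul1r) -W; ring.
    by rewrite Z pW !mulr0 subr0.
  - transitivity (t x * (wt x * A x + wf x * B x) - wt x * (t x * A x + f x * B x)).
      by rewrite -[LHS](mul1r) -W; ring.
    by rewrite Z pW !mulr0 subr0.
(* Continuity upgrades the vanishing from almost every point to every point, which the second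
   differentiation needs. *)
have A0 x : 0 < x -> A x = 0.
  by apply: cae_eq0 => //; apply: ae_imp AB => y + y0 => /(_ y0)[].
have B0 x : 0 < x -> B x = 0.
  by apply: cae_eq0 => //; apply: ae_imp AB => y + y0 => /(_ y0)[].
apply: ae_imp2 dA dB => x DA DB x0; have {}DA := DA x0; have {}DB := DB x0.
have nx : \forall y \near x, 0 < y by exact: lt_nbhsr.
have fm0 : f x * m x = 0.
  apply: (cder_unique DA); apply: cder_near (cder_cst 0 x).
  by apply: filterS nx => y /A0.
have tm0 : - (t x * m x) = 0.
  apply: (cder_unique DB); apply: cder_near (cder_cst 0 x).
  by apply: filterS nx => y /B0.
rewrite -[LHS]mul1r -(fund_wronskian x0).
transitivity (- wf x * (- (t x * m x)) - wt x * (f x * m x)); first by ring.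
by rewrite fm0 tm0 !mulr0 subr0.
Qed.

End Pair.
End Green.

(** * Density of continuous functions in L^2 *)

Section Clamp.
Context {R : realType}.
Implicit Types (m x y b : R).

(** Truncation to [-m, m] for m >= 0. Written with absolute values, like [ramp], which falls
    linearly from 1 at b to 0 at b + 1, so that continuity is immediate and estimates reduce to sign
    cases. *)
Definition clamp m y : R := (`|y + m| - `|y - m|) / 2.
Definition ramp b x : R := (1 + `|b + 1 - x| - `|b - x|) / 2.

Lemma norm_cases y : (0 <= y /\ `|y| = y) \/ (y <= 0 /\ `|y| = - y).
Proof. by have [y0|/ltW y0] := lerP 0 y; [left; rewrite ger0_norm|right; rewrite ler0_norm]. Qed.

Lemma clamp_id m y : `|y| <= m -> clamp m y = y.
Proof.
rewrite /clamp; case: (norm_cases y) => -[? ->]; case: (norm_cases (y + m)) => -[? ->];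
  case: (norm_cases (y - m)) => -[? ->]; lra.
Qed.

Lemma clamp_bound m y : 0 <= m -> `|clamp m y| <= m.
Proof.
rewrite /clamp => m0; case: (norm_cases (y + m)) => -[? ->];
  case: (norm_cases (y - m)) => -[? ->]; rewrite ler_norml; lra.
Qed.

Lemma clamp_lip m x y : `|clamp m x - clamp m y| <= `|x - y|.
Proof.
rewrite /clamp; have A := ler_dist_dist (x + m) (y + m).
have B := ler_dist_dist (x - m) (y - m).
rewrite (_ : x + m - (y + m) = x - y) in A; last by ring.
rewrite (_ : x - m - (y - m) = x - y) in B; last by ring.
move: A B; rewrite !ler_norml => /andP[A1 A2] /andP[B1 B2]; lra.
Qed.

Lemma clamp0 m : clamp m 0 = 0.
Proof. by rewrite /clamp add0r sub0r normrN subrr mul0r. Qed.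

Lemma clamp_le m y : `|clamp m y| <= `|y|.
Proof. by have := clamp_lip m y 0; rewrite clamp0 !subr0. Qed.

Lemma clamp_shrink m y (e : R) : 0 <= m -> 0 <= e <= 1 -> `|y - e * clamp m y| <= `|y|.
Proof.
rewrite /clamp => m0 /andP[e0 e1].
case: (norm_cases y) => -[? ->]; case: (norm_cases (y + m)) => -[? ->];
  case: (norm_cases (y - m)) => -[? ->]; rewrite ler_norml; nra.
Qed.

Lemma ramp1 b x : x <= b -> ramp b x = 1.
Proof.
rewrite /ramp => xb; case: (norm_cases (b + 1 - x)) => -[? ->];
  case: (norm_cases (b - x)) => -[? ->]; lra.
Qed.

Lemma ramp0 b x : b + 1 <= x -> ramp b x = 0.
Proof.
rewrite /ramp => xb; case: (norm_cases (b + 1 - x)) => -[? ->];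
  case: (norm_cases (b - x)) => -[? ->]; lra.
Qed.

Lemma ramp01 b x : 0 <= ramp b x <= 1.
Proof.
rewrite /ramp; case: (norm_cases (b + 1 - x)) => -[? ->];
  case: (norm_cases (b - x)) => -[? ->]; lra.
Qed.

Lemma clamp_continuous m : continuous (clamp m).
Proof.
move=> y; rewrite /clamp; apply: cvgMl; apply: cvgB; apply: cvg_norm;
  apply: cvgD => //; try exact: cvg_id; exact: cvg_cst.
Qed.

Lemma ramp_continuous b : continuous (ramp b).
Proof.
move=> y; rewrite /ramp; apply: cvgMl; apply: cvgB.
  apply: cvgD; [exact: cvg_cst|apply: cvg_norm; apply: cvgB; [exact: cvg_cst|exact: cvg_id]].
apply: cvg_norm; apply: cvgB; [exact: cvg_cst|exact: cvg_id].
Qed.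

End Clamp.

Section Density.
Context {R : realType}.
Notation mu := (@lebesgue_measure R).
Notation Rplus := (@Rplus R).
Implicit Types (f g : R -> R) (u : R -> R[i]).

Definition trunc (n : nat) f : R -> R := fun x => ramp n%:R x * clamp n%:R (f x).

Lemma trunc_measurable n f : measurable_fun Rplus f -> measurable_fun Rplus (trunc n f).
Proof.
move=> mf; apply: measurable_funM.
  by apply: measurable_funTS; apply: continuous_measurable_fun; exact: ramp_continuous.
apply: measurableT_comp => //; apply: continuous_measurable_fun; exact: clamp_continuous.
Qed.

Lemma trunc_bound n f x : `|trunc n f x| <= n%:R.
Proof.
rewrite normrM; have := ramp01 n%:R x => /andP[r0 r1]; rewrite (ger0_norm r0).
have n0 : 0 <= n%:R :> R by [].
by have := clamp_bound (f x) n0; have := normr_ge0 (clamp n%:R (f x)); nra.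
Qed.

(** Dominated convergence with majorant f^2: at a given x, the truncation equals f as soon as n
    exceeds both x and |f x|. *)
Lemma trunc_approx f (e : R) : measurable_fun Rplus f -> L1 (fun x => f x ^+ 2) -> 0 < e ->
  exists n : nat, rint (fun x => (f x - trunc n f x) ^+ 2) < e.
Proof.
move=> mf f2 e0.
pose F n x := ((f x - trunc n f x) ^+ 2)%:E.
have [] := @dominated_convergence _ _ _ mu Rplus mRplus F (cst 0%E) (EFin \o (fun x => f x ^+ 2)).
- move=> n; apply/measurable_EFinP; apply: measurable_funX; apply: measurable_funB => //.
  exact: trunc_measurable.
- exact: measurable_cst.
- apply: aeW => x xR; apply: cvg_near_cst.
  have M0 : 0 <= Num.max `|f x| x by rewrite le_max normr_ge0.
  exists (Num.bound (Num.max `|f x| x)) => //= n /= Hn.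
  have H : Num.max `|f x| x < n%:R.
    by apply: (lt_le_trans (archi_boundP M0)); rewrite ler_nat.
  move: H; rewrite gt_max => /andP[H1 H2].
  by rewrite /F /trunc ramp1 ?ltW // clamp_id ?ltW // mul1r subrr expr0n.
- exact: f2.
- apply: aeW => x n xR; rewrite /F /= lee_fin ger0_norm ?sqr_ge0 //.
  rewrite -[leLHS]real_normK ?num_real // -[leRHS]real_normK ?num_real //.
  by rewrite lerXn2r ?nnegrE // clamp_shrink // ramp01.
move=> _ _; rewrite integral0.
move=> /fine_cvgP[_ /cvgrPdist_lt /(_ e e0)[n _ Hn]].
exists n; have := Hn n (leqnn n); rewrite /= sub0r normrN; apply: le_lt_trans.
exact: ler_norm.
Qed.

Lemma mu_itv0_lty (b : R) : (mu `]0%R, b[%classic < +oo)%E.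
Proof. by rewrite lebesgue_measure_itv; case: ifP => _; rewrite ?ltry. Qed.

Lemma L1_approx f (b e : R) : mu.-integrable (`]0, b[%classic : set R) (EFin \o f) -> 0 < e ->
  exists2 g, continuous g & mu.-integrable (`]0, b[%classic : set R) (EFin \o (fun x => `|f x - g x|)) /\
    \int[mu]_(x in `]0, b[) `|f x - g x| < e.
Proof.
move=> fi e0.
have mE : measurable (`]0, b[%classic : set (measurableTypeR R)) by exact: measurable_itv.
have Ef := mu_itv0_lty b.
have [g_ [cg gi]] := approximation_continuous_integrable mE Ef fi.
move=> /fine_cvgP[_ /cvgrPdist_lt /(_ e e0)[n _ Hn]].
exists (g_ n) => //; split.
  by apply: integrable_norm; exact: (rintegrableB mE fi (gi n)).
have := Hn n (leqnn n); rewrite /= sub0r normrN; apply: le_lt_trans.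
exact: ler_norm.
Qed.

(** An L^1 approximation of the truncation h is upgraded to L^2: with the approximant g also clamped
    to [-n, n], one has |h - g|^2 <= 2 n |h - g0|. *)
Lemma real_dense f (e : R) : measurable_fun Rplus f -> L1 (fun x => f x ^+ 2) -> 0 < e ->
  exists g, [/\ continuous g, (\forall x \near +oo, g x = 0) &
    rint (fun x => (f x - g x) ^+ 2) < e].
Proof.
move=> mf f2 e0.
have e4 : 0 < e / 4 by lra.
have [n Hn] := trunc_approx mf f2 e4.
pose h := trunc n f; have mh : measurable_fun Rplus h by exact: trunc_measurable.
pose b : R := n%:R + 2.
pose E : set R := `]0, b[%classic.
have sE : E `<=` Rplus := @sub_Rplus _ b true.
have mE : measurable (E : set (measurableTypeR R)) by exact: measurable_itv.
have hi : mu.-integrable E (EFin \o h).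
  apply: measurable_bounded_integrable => //.
  - exact: mu_itv0_lty.
  - by apply: (measurable_funS _ sE mh); exact: mRplus.
  - exists n%:R; split; rewrite ?num_real // => y ny x _.
    by apply: (le_trans (trunc_bound _ _ _)); exact: ltW.
(* Multiplied by 2 * 2 n this stays below e / 2; the other half is twice the truncation error e /
   4. *)
have d0 : 0 < e / (8 * (n%:R + 1)) by rewrite divr_gt0 ?mulr_gt0 ?ltr_wpDl.
have [g0 cg0 [gi Hg]] := L1_approx hi d0.
(* This ramp is 1 up to n + 1, where h may be nonzero, and 0 from b = n + 2 on. *)
pose g x := ramp (n%:R + 1) x * clamp n%:R (g0 x).
have cg : continuous g.
  move=> x; apply: cvgM; first exact: ramp_continuous.
  by apply: continuous_comp; [exact: cg0|exact: clamp_continuous].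
exists g; split => //.
  exists b; split; rewrite ?num_real // => x bx; rewrite /g ramp0 ?mul0r //.
  by move: bx; rewrite /b; lra.
pose k : R -> R := (fun x => `|h x - g0 x|) \_ E.
have k1 : L1 k.
  by apply: integrableS (integrable_patch mE gi) => //; exact: mRplus.
have kE : rint k < e / (8 * (n%:R + 1)).
  apply: le_lt_trans Hg; rewrite /rint /k -Rintegral_mkcondr.
  by rewrite (setIidr sE).
have n0 : 0 <= n%:R :> R by [].
have pw x : 0 < x -> (h x - g x) ^+ 2 <= (2 * n%:R) * k x.
  move=> x0; rewrite /k patchE; case: (ltP x b) => xb; last first.
    rewrite memNset /E /= ?in_itv /= ?x0 /= ?ltNge ?xb // mulr0.
    rewrite /h /g /trunc !ramp0 ?mul0r ?subrr ?expr0n //; move: xb; rewrite /b; lra.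
  rewrite mem_set /E /= ?in_itv /= ?x0 ?xb //.
  have A : `|h x - g x| <= `|h x - g0 x|.
    case: (lerP x (n%:R + 1)) => xn.
      have hx : clamp n%:R (h x) = h x := clamp_id (trunc_bound n f x).
      by rewrite /g ramp1 // mul1r -{1}hx; exact: clamp_lip.
    rewrite /h /trunc ramp0 ?(ltW xn) // mul0r !sub0r !normrN /g normrM.
    have /andP[r0 r1] := ramp01 (n%:R + 1) x; rewrite (ger0_norm r0).
    by have := clamp_le n%:R (g0 x); have := normr_ge0 (clamp n%:R (g0 x)); nra.
  have B : `|h x - g x| <= 2 * n%:R.
    apply: (le_trans (ler_normB _ _)).
    have := trunc_bound n f x; rewrite -/(h x).
    have : `|g x| <= n%:R.
      rewrite normrM; have /andP[r0 r1] := ramp01 (n%:R + 1) x; rewrite (ger0_norm r0).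
      by have := clamp_bound (g0 x) n0; have := normr_ge0 (clamp n%:R (g0 x)); nra.
    lra.
  by rewrite -real_normK ?num_real // expr2; apply: ler_pM.
have fh1 : L1 (fun x => (f x - h x) ^+ 2).
  apply: (@le_integrable _ _ _ mu _ mRplus _ (EFin \o (fun x => f x ^+ 2))) => //.
  - by apply/measurable_EFinP; apply: measurable_funX; apply: measurable_funB.
  - move=> x _; rewrite /= lee_fin !ger0_norm ?sqr_ge0 //.
    rewrite -[leLHS]real_normK ?num_real // -[leRHS]real_normK ?num_real //.
    by rewrite lerXn2r ?nnegrE // clamp_shrink // ramp01.
have tot1 : L1 (fun x => 2 * (f x - h x) ^+ 2 + 2 * (2 * n%:R) * k x).
  by apply: L1D; exact: L1Z.
apply: (@le_lt_trans _ _ (rint (fun x => 2 * (f x - h x) ^+ 2 + 2 * (2 * n%:R) * k x))).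
  have ptw x : 0 < x -> (f x - g x) ^+ 2 <= 2 * (f x - h x) ^+ 2 + 2 * (2 * n%:R) * k x.
    move=> x0; have := pw x x0; have := sqr_ge0 ((f x - h x) - (h x - g x)).
    move: (f x) (h x) (g x) (k x) => *; nra.
  have fg1 : L1 (fun x => (f x - g x) ^+ 2).
    apply: (@le_integrable _ _ _ mu _ mRplus _ (EFin \o (fun x => 2 * (f x - h x) ^+ 2 + 2 * (2 * n%:R) * k x))) => //.
    - apply/measurable_EFinP; apply: measurable_funX; apply: measurable_funB => //.
      by apply: measurable_funTS; exact: continuous_measurable_fun.
    - move=> x /Rplus_gt0 x0; rewrite /= lee_fin ger0_norm ?sqr_ge0 //.
      by apply: le_trans (ptw x x0) _; exact: ler_norm.
  by apply: le_Rintegral => //; [exact: mRplus|move=> x /Rplus_gt0; exact: ptw].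
rewrite rintD; [|exact: L1Z..]; rewrite !rintZ //.
have : 2 * (2 * n%:R) * rint k <= e / 2.
  apply: (@le_trans _ _ (2 * (2 * n%:R) * (e / (8 * (n%:R + 1))))).
    by apply: ler_wpM2l; [rewrite !mulr_ge0|exact: ltW].
  rewrite (_ : 2 * (2 * n%:R) * (e / (8 * (n%:R + 1))) = (e / 2) * (n%:R / (n%:R + 1))).
    rewrite ler_piMr //; first by lra.
    by rewrite ler_pdivrMr ?mul1r ?ltr_wpDl //; lra.
  by field; rewrite gt_eqF // ltr_wpDl.
move: Hn; rewrite -/h; lra.
Qed.

Lemma L2_dense u (e : R) : L2 u -> 0 < e ->
  exists v, [/\ (forall x : R, 0 < x -> ccont v x), L2 v,
    (\forall x \near +oo, v x = 0) & sqnorm (fun x => u x - v x) < e].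
Proof.
move=> u2 e0; have [m1 m2] := L2_meas u2; have s1 := L2_sq u2.
have e2 : 0 < e / 2 by lra.
have r1 : L1 (fun x => re u x ^+ 2).
  apply: (@le_integrable _ _ _ mu _ mRplus _ (EFin \o sq u)) => //.
    by apply/measurable_EFinP; exact: measurable_funX.
  by move=> x _; rewrite /= lee_fin !ger0_norm ?sqr_ge0 // sqE lerDl sqr_ge0.
have i1 : L1 (fun x => im u x ^+ 2).
  apply: (@le_integrable _ _ _ mu _ mRplus _ (EFin \o sq u)) => //.
    by apply/measurable_EFinP; exact: measurable_funX.
  by move=> x _; rewrite /= lee_fin !ger0_norm ?sqr_ge0 // sqE lerDr sqr_ge0.
have [g [cg g0 Hg]] := real_dense m1 r1 e2.
have [h [ch h0 Hh]] := real_dense m2 i1 e2.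
pose v x := g x +i* h x.
have cv x : ccont v x by split; [exact: cg|exact: ch].
have v0 : \forall x \near +oo, v x = 0 by apply: filterS2 g0 h0 => x; rewrite /v => -> ->.
have v2 : L2 v.
  apply: (@L2_bounded_supp _ v (v 0)) => //.
  by have [c1 c2] := cv 0; split; apply: cvg_at_right_filter.
exists v; split => //.
have w2 := L2B u2 v2; have [mw1 mw2] := L2_meas w2; have sw := L2_sq w2.
have E1 x : re (fun x => u x - v x) x = re u x - g x by rewrite /re cReD cReN.
have E2 x : im (fun x => u x - v x) x = im u x - h x by rewrite /im cImD cImN.
have l1 : L1 (fun x => (re u x - g x) ^+ 2).
  apply: (@le_integrable _ _ _ mu _ mRplus _ (EFin \o sq (fun x => u x - v x))) => //.
    apply/measurable_EFinP; apply: measurable_funX; apply: measurable_funB => //.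
    by apply: measurable_funTS; exact: continuous_measurable_fun.
  by move=> x _; rewrite /= lee_fin !ger0_norm ?sqr_ge0 // sqE E1 lerDl sqr_ge0.
have l2 : L1 (fun x => (im u x - h x) ^+ 2).
  apply: (@le_integrable _ _ _ mu _ mRplus _ (EFin \o sq (fun x => u x - v x))) => //.
    apply/measurable_EFinP; apply: measurable_funX; apply: measurable_funB => //.
    by apply: measurable_funTS; exact: continuous_measurable_fun.
  by move=> x _; rewrite /= lee_fin !ger0_norm ?sqr_ge0 // sqE E2 lerDr sqr_ge0.
rewrite /sqnorm (_ : sq _ = fun x => (re u x - g x) ^+ 2 + (im u x - h x) ^+ 2); last first.
  by apply/funext => x; rewrite sqE E1 E2.
rewrite rintD //; lra.
Qed.

End Density.

(** * Further rules for L^2 norms and pairings *)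

Section L2extra.
Context {R : realType}.
Notation mu := (@lebesgue_measure R).
Notation Rplus := (@Rplus R).
Implicit Types (u v g h : R -> R[i]) (x : R).

Lemma cmeas_eq u v : (forall x, 0 < x -> u x = v x) -> cmeas u -> cmeas v.
Proof.
move=> uv [m1 m2]; split.
- by apply: eq_measurable_fun m1 => x /set_mem /Rplus_gt0 x0; rewrite /re uv.
- by apply: eq_measurable_fun m2 => x /set_mem /Rplus_gt0 x0; rewrite /im uv.
Qed.

Lemma L2_eq u v : (forall x, 0 < x -> u x = v x) -> L2 u -> L2 v.
Proof.
move=> uv /L2P[m s]; apply: (L2_le (cmeas_eq uv m) s) => x x0.
by rewrite /sq uv.
Qed.

Lemma sqnorm_eq u v : (forall x, 0 < x -> u x = v x) -> sqnorm u = sqnorm v.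
Proof. by move=> uv; apply: eq_Rintegral => x /set_mem /Rplus_gt0 x0; rewrite /sq uv. Qed.

Lemma L2normE u : L2norm u = Num.sqrt (sqnorm u).
Proof. by []. Qed.

Lemma L2norm_lt u (e : R) : 0 < e -> (L2norm u < e) = (sqnorm u < e ^+ 2).
Proof.
move=> e0; have eE : e = Num.sqrt (e ^+ 2) by rewrite sqrtr_sqr gtr0_norm.
by rewrite L2normE {1}eE ltr_sqrt // exprn_gt0.
Qed.

Lemma cint_conj_self u : L2 u -> cint (fun x => u x * (u x)^*%C) = (sqnorm u)%:C.
Proof.
move=> u2; apply: complex_ext => /=.
- apply: eq_Rintegral => x _; rewrite /re cReM cReC cImC sqE /re /im; ring.
- rewrite /Rintegral integral0_eq // => x _; rewrite /im cImM cReC cImC.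
  by congr EFin; ring.
Qed.

Lemma small_eq0 (y C : R) : 0 <= y -> 0 <= C -> (forall e : R, 0 < e -> y <= C * e) -> y = 0.
Proof.
move=> y0 C0 H; apply/eqP; rewrite eq_le y0 andbT; apply/ler_addgt0Pl => e e0.
have C1 : 0 < C + 1 by lra.
rewrite addr0; apply: (le_trans (H (e / (C + 1)) _)); first by rewrite divr_gt0.
by rewrite mulrA ler_pdivrMr // mulrC ler_pM2l //; lra.
Qed.

Lemma cL1_0 : cL1 (fun=> 0 : R[i]).
Proof. exact: cintegrable0. Qed.

Lemma cint_supp u x : 0 < x -> cL1 u -> (forall y, x < y -> u y = 0) -> cint u = cprim u x.
Proof.
move=> x0 u1 ux; have := cint_tail x0 u1 cL1_0 ux.
have -> : cint (fun=> 0 : R[i]) = 0 by rewrite /cint /cintegral /Rintegral integral0.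
have -> : cprim (fun=> 0 : R[i]) x = 0 by rewrite /cprim /cintegral /Rintegral integral0.
by rewrite subrr => /eqP; rewrite subr_eq0 => /eqP.
Qed.

Lemma green_B f t h k x : L2 f -> L2 t -> L2 h -> L2 k ->
  green f t (fun x => h x - k x) x = green f t h x - green f t k x.
Proof.
move=> f2 t2 h2 k2; have nk2 := L2Z (-1) k2.
have -> : green f t (fun x => h x - k x) x = green f t (fun x => h x + (-1) * k x) x.
  by apply: green_eq => y _; rewrite mulN1r.
by rewrite (green_D x f2 t2 h2 nk2) (green_Z (-1) x f2 t2 k2) mulN1r.
Qed.

Lemma ae_Rplus (P : R -> Prop) : (forall x, 0 < x -> P x) -> {ae mu, forall x, Rplus x -> P x}.
Proof. by move=> H; apply: aeW => x /Rplus_gt0; exact: H. Qed.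

End L2extra.

(** * The minimal operator *)

Section PairOperators.
Context {R : realType} (p q : R -> R) (p0 : R).
Hypotheses (p_C1 : Cn 1 p) (q_C0 : Cn 0 q) (p_gt0 : forall x : R, 0 < x -> 0 < p x).
Hypotheses (p_lim0 : p x @[x --> 0^'+] --> p0) (p0_gt0 : 0 < p0).
Context (alpha : option R).
Notation mu := (@lebesgue_measure R).
Notation Rplus := (@Rplus R).
Implicit Types (u v g h k : R -> R[i]) (x : R).

(** The values at 0 of phi, p phi', theta and p theta', in the order a, b, c, d. *)
Let a : R[i] := (phi_init alpha).1.
Let b : R[i] := p0%:C * (phi_init alpha).2.
Let c : R[i] := (theta_init p0 alpha).1.
Let d : R[i] := p0%:C * (theta_init p0 alpha).2.

Lemma p0_mulV : p0%:C * p0^-1%:C = 1 :> R[i].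
Proof. by rewrite -rmorphM /= mulfV ?gt_eqF. Qed.

Lemma det_init : b * c - a * d = 1.
Proof.
rewrite /a /b /c /d; case: alpha => [al|] /=.
- by rewrite mulr0 sub0r mul1r mulrN opprK p0_mulV.
- by rewrite mul0r subr0 mulr1 p0_mulV.
Qed.

(** (BC) makes (e1, e2) proportional to the initial values of phi, so the Wronskian with phi
    vanishes at 0, for finite and infinite alpha alike. *)
Lemma BC_det e1 e2 : BC alpha (e1, e2) -> b * e1 - a * (p0%:C * e2) = 0.
Proof.
rewrite /BC /a /b; case: alpha => [al|] /= ->; first by ring.
by ring.
Qed.

Lemma BC_scale e : BC alpha ((phi_init alpha).1 * e, (phi_init alpha).2 * e).
Proof. by rewrite /BC; case: alpha => [al|] /=; ring. Qed.

Section Pair.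
Context (z : R[i]) (f wf t wt : R -> R[i]).
Hypothesis (F : fundamental p q z f wf t wt a b c d).
Let f2 := fund_f2 F.
Let t2 := fund_t2 F.
Notation S := (green f t).

(** Green's formula at a point Y beyond the support: the boundary terms at Y are zero, and (BC)
    removes the Wronskian with f at 0. *)
Lemma A00_green u g : A00 p q alpha (u, g) ->
  [/\ L2 u, L2 g, (forall x, 0 < x -> S (fun x => g x - z * u x) x = u x) &
      cint (fun x => f x * (g x - z * u x)) = 0].
Proof.
move=> [/= gE u2 [X [_ uX]] [[e1 e2] bv bc]]; rewrite -gE => g2.
have Q : QD p q u (fun x => (p x)%:C * cderiv u x) g by rewrite gE; exact: cCn2_QD.
have [/= ue we] := boundary_quasi p_lim0 bv.
have cu x : 0 < x -> ccont u x by move=> x0; have [] := QD_ccont Q x0.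
have cg x : 0 < x -> ccont g x by move=> x0; rewrite gE; exact: calA_ccont.
have Lu : L2 u.
  by apply: (L2_bounded_supp cu ue); exists X; split; rewrite ?num_real.
have k2 : L2 (fun x => g x - z * u x) by apply: L2B => //; exact: L2Z.
have ck x : 0 < x -> ccont (fun x => g x - z * u x) x.
  move=> x0; apply: climB; [exact: cg|apply: climM; [exact: clim_cst|exact: cu]].
pose Y := Num.max X 0 + 1.
have XY : X < Y by rewrite /Y; have := @le_max _ _ X X 0; rewrite lexx /= => h; lra.
have Y0 : 0 < Y by rewrite /Y; have := @le_max _ _ 0 X 0; rewrite lexx orbT => h; lra.
have u0 x : X < x -> u x = 0 := uX x.
have g0 x : X < x -> g x = 0.
  move=> xX; have : \forall y \near x, u y = 0.
    by have : \forall y \near x, X < y by [exact: lt_nbhsr]; apply: filterS => y; exact: u0.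
  move=> E; rewrite gE (calA_near p q E).
  have /cder_cderiv E0 : cder (fun=> 0 : R[i]) x 0 by exact: cder_cst.
  rewrite /calA mulr0 addr0 (_ : (fun y => _) = fun=> 0) ?E0 ?oppr0 //.
  apply/funext => y; have /cder_cderiv -> : cder (fun=> 0 : R[i]) y 0 by exact: cder_cst.
  by rewrite mulr0.
have du0 : cderiv u Y = 0.
  rewrite (@cderiv_near _ _ (fun=> 0)); first by apply: cder_cderiv; exact: cder_cst.
  by have : \forall y \near Y, X < y by [exact: lt_nbhsr]; apply: filterS => y; exact: u0.
have form (x : R) (x0 : 0 < x) := @green_formula _ p q z f wf t wt a b c d F u _ g _ e1 _ x Q (fun _ _ => erefl) ck k2 ue we x0.
have tail v : L2 v -> cint (fun x => v x * (g x - z * u x)) = cprim (fun x => v x * (g x - z * u x)) Y.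
  move=> v2; apply: (cint_supp Y0 (L2M v2 k2)) => y Yy.
  have Xy : X < y := lt_trans XY Yy.
  by rewrite (g0 y Xy) (u0 y Xy) mulr0 subr0 mulr0.
have [E1 E2 _] := form Y Y0.
have uY := u0 Y XY.
split => //.
- move=> x x0; have [_ _ ->] := form x x0.
  rewrite tail // E2 uY du0 (BC_det bc); ring.
- rewrite tail // E1 uY du0 (BC_det bc); ring.
Qed.

(** Beyond the support of h the tail integral is 0, and the primitive of f h has reached (f, h) = 0;
    hence S h vanishes there. *)
Lemma green_A00 h : L2 h -> (forall x, 0 < x -> ccont h x) ->
  (\forall x \near +oo, h x = 0) -> cint (fun x => f x * h x) = 0 ->
  A00 p q alpha (S h, calA p q (S h)) /\
  forall x, 0 < x -> calA p q (S h) x = h x + z * S h x.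
Proof.
move=> h2 ch [X [_ hX]] fh.
have Q := green_QD F h2 ch.
have cS x : 0 < x -> ccont (S h) x by exact: green_ccont F _ _ h2.
have cg x : 0 < x -> ccont (fun x => h x + z * S h x) x.
  by move=> x0; apply: climD; [exact: ch|apply: climM; [exact: clim_cst|exact: cS]].
have AE x : 0 < x -> calA p q (S h) x = h x + z * S h x.
  by move=> x0; have [] := QD_cderiv p_gt0 Q x0.
split; last exact: AE.
split; [exact: erefl| | | |].
- exact: QD_cCn2 p_C1 q_C0 p_gt0 _ _ _ Q cg.
- exists (Num.max X 0); split; rewrite ?num_real // => x; rewrite gt_max => /andP[Xx x0].
  have tail v : L2 v -> cint (fun x => v x * h x) - cprim (fun x => v x * h x) x = 0.
    move=> v2; apply/eqP; rewrite subr_eq0; apply/eqP.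
    apply: (cint_supp x0 (L2M v2 h2)) => y xy.
    by rewrite (hX y (lt_trans Xx xy)) mulr0.
  change (S h x = 0); rewrite /green tail // mulr0 addr0.
  by have := tail _ f2; rewrite fh sub0r => /eqP; rewrite oppr_eq0 => /eqP ->; rewrite mulr0.
- change (exists2 b0, boundary_values (S h) b0 & BC alpha b0).
  exists ((phi_init alpha).1 * cint (fun y => t y * h y), (phi_init alpha).2 * cint (fun y => t y * h y)); last exact: BC_scale.
  split; first exact: (green_lim0 F h2).
  have -> : (phi_init alpha).2 * cint (fun y => t y * h y) = p0^-1%:C * (b * cint (fun y => t y * h y)).
    by rewrite /b !mulrA [p0^-1%:C * _]mulrC p0_mulV mul1r.
  have L : clim (0^'+) (fun x => (p x)^-1%:C * greenw f wf t wt h x) (p0^-1%:C * (b * cint (fun y => t y * h y))).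
    apply: climM; last exact: (greenw_lim0 F h2).
    by apply: clim_real; apply: cvgV; rewrite ?gt_eqF.
  apply: clim_near L; near=> x.
  have x0 : 0 < x by near: x; exact: nbhs_right_gt.
  by have [-> _] := QD_cderiv p_gt0 Q x0.
- change (L2 (calA p q (S h))).
  apply: L2_eq (L2D h2 (L2Z z (green_L2 F h2))) => x x0.
  by rewrite AE.
Unshelve. all: by end_near. Qed.

(** If f were zero, its quasi-derivative would be too, against Wronskian 1. *)
Lemma fund_sqnorm_neq0 : sqnorm f != 0.
Proof.
apply/eqP => /(sqnorm_eq0 f2) f0.
have {}f0 x : 0 < x -> f x = 0.
  apply: cae_eq0 => [y y0|]; first by have [] := QD_ccont (fund_f F) y0.
  by apply: ae_imp f0 => y H y0; apply: H; rewrite RplusE.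
have wf0 x : 0 < x -> wf x = 0.
  move=> x0; have [D _] := fund_f F x0.
  have E : (p x)^-1%:C * wf x = 0.
    apply: (cder_unique D); apply: cder_near (cder_cst 0 x).
    by have : \forall y \near x, 0 < y by [exact: lt_nbhsr]; apply: filterS => y /f0.
  by rewrite -[wf x]mul1r -(p_mulV p_gt0 x0) -mulrA E mulr0.
have := fund_wronskian F ltr01; rewrite f0 // wf0 // !mul0r subrr => /eqP.
by rewrite eq_sym oner_eq0.
Qed.

Lemma fund_pairing : exists k, [/\ (forall x, 0 < x -> ccont k x), L2 k,
  (\forall x \near +oo, k x = 0) & cint (fun x => f x * k x) = 1].
Proof.
have Nf : 0 < sqnorm f by rewrite lt_def fund_sqnorm_neq0 sqnorm_ge0.
(* With v this close to the conjugate of f, (f, v) = 0 would give N^2 <= 2 N (N / 4) for N =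
   [sqnorm f], impossible as N > 0. *)
have Nf4 : 0 < sqnorm f / 4 by lra.
have [v [cv v2 v0 Hv]] := L2_dense (L2_conj f2) Nf4.
have nz : cint (fun x => f x * v x) != 0.
  apply/eqP => E.
  have := cint_CS f2 (L2B (L2_conj f2) v2).
  have -> : cint (fun x => f x * ((f x)^*%C - v x)) = (sqnorm f)%:C.
    rewrite -cint_conj_self // -[RHS]subr0 -[X in _ = _ - X]E -cintB; [|exact: L2M (L2_conj _)|exact: L2M].
    by apply: eq_cint => x _; rewrite mulrBr.
  by rewrite normc_sqr /= expr0n addr0; nra.
exists (fun x => (cint (fun x => f x * v x))^-1 * v x); split.
- by move=> x x0; apply: climM; [exact: clim_cst|exact: cv].
- exact: L2Z.
- by apply: filterS v0 => x ->; rewrite mulr0.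
- transitivity (cint (fun x => (cint (fun x => f x * v x))^-1 * (f x * v x))).
    by apply: eq_cint => x _; rewrite mulrCA.
  by rewrite cintZ ?mulVf //; exact: L2M.
Qed.

(** Subtracting l k with (f, k) = 1 and l = (f, v) restores orthogonality; l is small because (f, h)
    = 0. *)
Lemma dense_orthogonal h (e : R) : L2 h -> cint (fun x => f x * h x) = 0 -> 0 < e ->
  exists v, [/\ (forall x, 0 < x -> ccont v x), L2 v, (\forall x \near +oo, v x = 0),
    cint (fun x => f x * v x) = 0 & sqnorm (fun x => h x - v x) < e].
Proof.
move=> h2 fh e0; have [k [ck k2 k0 fk]] := fund_pairing.
(* The factor by which the correction can enlarge the error: 2 for h - v, and 2 |l|^2 [sqnorm k]
   with |l|^2 at most 2 [sqnorm f] times that error. *)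
have C0 : 0 < 2 + 4 * (sqnorm f * sqnorm k) by have := sqnorm_ge0 f; have := sqnorm_ge0 k; nra.
have e1 : 0 < e / (2 + 4 * (sqnorm f * sqnorm k)) by rewrite divr_gt0.
have [v [cv v2 v0 Hv]] := L2_dense h2 e1.
pose l := cint (fun x => f x * v x).
have lE : l = - cint (fun x => f x * (h x - v x)).
  transitivity (- (cint (fun x => f x * h x) - cint (fun x => f x * v x))).
    by rewrite fh sub0r opprK.
  rewrite -cintB; [|exact: L2M..]; congr (- _); apply: eq_cint => x _; ring.
have hv2 := L2B h2 v2.
exists (fun x => v x - l * k x); split.
- move=> x x0; apply: climB; [exact: cv|apply: climM; [exact: clim_cst|exact: ck]].
- by apply: L2B => //; exact: L2Z.
- by apply: filterS2 v0 k0 => x -> ->; rewrite mulr0 subr0.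
- transitivity (cint (fun x => f x * v x - l * (f x * k x))).
    by apply: eq_cint => x _; ring.
  rewrite cintB; [|exact: L2M|apply: cL1Z; exact: L2M].
  by rewrite cintZ ?fk ?mulr1 ?subrr //; exact: L2M.
- have -> : sqnorm (fun x => h x - (v x - l * k x)) = sqnorm (fun x => (h x - v x) + l * k x).
    by apply: sqnorm_eq => x _; ring.
  apply: (le_lt_trans (sqnorm_D hv2 (L2Z l k2))); rewrite sqnorm_Z //.
  have nl : Normc.normc l ^+ 2 <= 2 * (sqnorm f * sqnorm (fun x => h x - v x)).
    rewrite lE (_ : Normc.normc (- _) ^+ 2 = Normc.normc (cint (fun x => f x * (h x - v x))) ^+ 2).
      exact: cint_CS.
    by rewrite !normc_sqr cReN cImN !sqrrN.
  move: Hv; rewrite ltr_pdivlMr // => Hv.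
  have := sqnorm_ge0 k; have := sqnorm_ge0 f; have := sqnorm_ge0 (fun x => h x - v x).
  move: nl Hv; move: (Normc.normc l ^+ 2) (sqnorm (fun x => h x - v x)) (sqnorm f) (sqnorm k) => m n1 n2 n3 *; nra.
Qed.

Lemma Amin_green h : L2 h -> cint (fun x => f x * h x) = 0 ->
  Amin p q alpha (S h, fun x => h x + z * S h x).
Proof.
move=> h2 fh; have Sh := green_L2 F h2; split => /=.
- exact: Sh.
- by apply: L2D => //; exact: L2Z.
move=> e e0.
pose K := 20 * (sqnorm f * sqnorm t).
have K0 : 0 <= K by rewrite /K !mulr_ge0 ?sqnorm_ge0.
pose m := Normc.normc z ^+ 2.
have m0 : 0 <= m by exact: sqr_ge0.
(* Dominates both K, for the functions, and 2 + 2 m K, for their images. *)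
pose C := 3 + K + 2 * (m * K).
have C0 : 0 < C by rewrite /C; nra.
have e2 : 0 < e ^+ 2 / C by rewrite divr_gt0 ?exprn_gt0.
have [v [cv v2 v0 fv Hv]] := dense_orthogonal h2 fh e2.
have [A AE] := green_A00 v2 cv v0 fv.
have hv2 := L2B h2 v2.
have SB x : S h x - S v x = S (fun x => h x - v x) x.
  by rewrite green_B.
have NS := green_sqnorm F hv2.
exists (S v, calA p q (S v)); split => //=.
- rewrite L2norm_lt //.
  rewrite (@sqnorm_eq _ _ (S (fun x => h x - v x))) => [|x _]; last exact: SB.
  apply: (le_lt_trans NS); rewrite -/K.
  move: Hv; rewrite ltr_pdivlMr // /C => Hv.
  by have := sqnorm_ge0 (fun x => h x - v x); nra.
- rewrite L2norm_lt //.
  rewrite (@sqnorm_eq _ _ (fun x => (h x - v x) + z * S (fun x => h x - v x) x)) => [|x x0]; last first.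
    by rewrite AE // -SB; ring.
  apply: (le_lt_trans (sqnorm_D hv2 (L2Z z (green_L2 F hv2)))).
  rewrite sqnorm_Z; last exact: green_L2 F _ hv2.
  rewrite -/m; move: Hv NS; rewrite ltr_pdivlMr // /C -/K => Hv NS.
  have := sqnorm_ge0 (fun x => h x - v x); nra.
Qed.

(** Both relations hold on [A00] and are continuous for the graph norm, since S and the pairing with
    f are bounded; so they survive the closure. *)
Lemma Amin_repr u k : Amin p q alpha (u, k) ->
  [/\ L2 u, L2 k, u = S (fun x => k x - z * u x) %[ae mu in Rplus] &
      cint (fun x => f x * (k x - z * u x)) = 0].
Proof.
move=> [/= u2 k2 H].
have zu2 := L2Z z u2; have kz2 := L2B k2 zu2.
pose m := Normc.normc z ^+ 2.
have m0 : 0 <= m by exact: sqr_ge0.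
pose K := 20 * (sqnorm f * sqnorm t).
have K0 : 0 <= K by rewrite /K !mulr_ge0 ?sqnorm_ge0.
have approx (e : R) : 0 < e -> exists v g, [/\ L2 v, L2 g,
    (forall x, 0 < x -> S (fun x => g x - z * v x) x = v x) &
    cint (fun x => f x * (g x - z * v x)) = 0] /\
    (sqnorm (fun x => u x - v x) < e /\ sqnorm (fun x => (k x - z * u x) - (g x - z * v x)) <= (2 + 2 * m) * e).
  move=> e0; have s0 : 0 < Num.sqrt e by rewrite sqrtr_gt0.
  have [[v g] [/= A]] := H _ s0; rewrite !L2norm_lt // sqr_sqrtr ?ltW // => N1 N2.
  have [v2 g2 Sv fv] := A00_green A.
  exists v, g; split => //; split => //.
  have -> : sqnorm (fun x => (k x - z * u x) - (g x - z * v x)) =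
            sqnorm (fun x => (k x - g x) - z * (u x - v x)).
    by apply: sqnorm_eq => x _; ring.
  have uv2 := L2B u2 v2.
  apply: (le_trans (sqnorm_B (L2B k2 g2) (L2Z z uv2))); rewrite sqnorm_Z // -/m.
  have := sqnorm_ge0 (fun x => u x - v x); nra.
split => //.
- have Sk := green_L2 F kz2.
  suff /(sqnorm_eq0 (L2B u2 Sk)) : sqnorm (fun x => u x - S (fun x => k x - z * u x) x) = 0.
    by apply: ae_imp => x + xR => /(_ xR) /eqP; rewrite subr_eq0 => /eqP.
  (* 2 for u - v, and 2 K (2 + 2 m) for the image under S of the error in (A - z) u. *)
  apply: (@small_eq0 _ _ (2 + 2 * (K * (2 + 2 * m)))); [exact: sqnorm_ge0|nra|].
  move=> e e0; have [v [g [[v2 g2 Sv fv] [N1 N2]]]] := approx e e0.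
  have gz2 := L2B g2 (L2Z z v2); have uv2 := L2B u2 v2.
  have df2 := L2B kz2 gz2.
  have -> : sqnorm (fun x => u x - S (fun x => k x - z * u x) x) =
      sqnorm (fun x => (u x - v x) - S (fun x => (k x - z * u x) - (g x - z * v x)) x).
    apply: sqnorm_eq => x x0.
    rewrite (green_B x f2 t2 kz2 gz2).
    by rewrite Sv //; ring.
  apply: (le_trans (sqnorm_B uv2 (green_L2 F df2))).
  have NS := green_sqnorm F df2; rewrite -/K in NS.
  have := ler_wpM2l K0 N2; move: N1 NS.
  move: (sqnorm _) (sqnorm _) (sqnorm _) => n1 n2 n3; lra.
- suff E : Normc.normc (cint (fun x => f x * (k x - z * u x))) ^+ 2 = 0.
    by apply: Normc.eq0_normc; apply/eqP; rewrite -sqrf_eq0 E.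
  apply: (@small_eq0 _ _ (2 * (sqnorm f * (2 + 2 * m)))); [exact: sqr_ge0|by have := sqnorm_ge0 f; nra|].
  move=> e e0; have [v [g [[v2 g2 Sv fv] [N1 N2]]]] := approx e e0.
  have gz2 := L2B g2 (L2Z z v2).
  have -> : cint (fun x => f x * (k x - z * u x)) =
     cint (fun x => f x * ((k x - z * u x) - (g x - z * v x))).
    rewrite -[LHS]subr0 -[X in _ - X]fv -cintB; [|exact: L2M..].
    by apply: eq_cint => x _; ring.
  apply: (le_trans (cint_CS f2 (L2B kz2 gz2))).
  have := ler_wpM2l (sqnorm_ge0 f) N2; lra.
Qed.

End Pair.
End PairOperators.

Lemma resolventP (R : realType) (T : @operator R) z h u :
  resolvent T z (h, u) <-> T (u, fun x => h x + z * u x).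
Proof.
split.
- move=> [[v w] /= Tvw [<- <-]].
  suff -> : (fun x => w x - z * v x + z * v x) = w by [].
  by apply/funext => x; rewrite subrK.
- move=> H; exists (u, fun x => h x + z * u x) => //=.
  by congr (_, _); apply/funext => x; rewrite addrK.
Qed.

Lemma conjc_green (R : realType) (s1 s2 s3 s4 s5 : R[i]) :
  (s1 * s2 + s3 * (s4 - s5))^*%C =
  s1^*%C * s2^*%C + s3^*%C * (s4^*%C - s5^*%C).
Proof. by rewrite conjcD !conjcM conjcB. Qed.

Lemma conjc_lin (R : realType) (s1 s2 s3 : R[i]) :
  (s1 + s2 * s3)^*%C = s1^*%C + s2^*%C * s3^*%C.
Proof. by rewrite conjcD conjcM. Qed.

Lemma innerE (R : realType) (u v : R -> R[i]) : inner u v = cint (fun x => u x * (v x)^*%C).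
Proof. by []. Qed.

(** * Boundary values at infinity and the resolvent *)

Section Main.
Context (R : realType)
  (p q : R -> R) (p0 : R)
  (p_C1 : Cn 1 p) (q_C0 : Cn 0 q)
  (p_lim0 : p x @[x --> 0^'+] --> p0)
  (p_gt0 : forall x : R, 0 < x -> 0 < p x) (p0_gt0 : 0 < p0)
  (alpha : option R)
  (omega : R -> R) (omega_cutoff : cutoff omega)
  (phi theta : R[i] -> R -> R[i])
  (phi_sol : forall z, solution p q z (phi z))
  (phi_0 : forall z, boundary_values (phi z) (phi_init alpha))
  (theta_sol : forall z, solution p q z (theta z))
  (theta_0 : forall z, boundary_values (theta z) (theta_init p0 alpha))
  (phi_L2 : forall z, L2 (phi z)) (theta_L2 : forall z, L2 (theta z)).
Notation mu := (@lebesgue_measure R).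
Notation Rplus := (@Rplus R).
Implicit Types (u v g h k : R -> R[i]) (x : R) (z : R[i]).

Let a : R[i] := (phi_init alpha).1.
Let b : R[i] := p0%:C * (phi_init alpha).2.
Let c : R[i] := (theta_init p0 alpha).1.
Let d : R[i] := p0%:C * (theta_init p0 alpha).2.
Let quasi u : R -> R[i] := fun x => (p x)%:C * cderiv u x.
Notation S z := (green (phi z) (theta z)).
Notation pair u v := (cint (fun x => u x * v x)).

Lemma fund z : fundamental p q z (phi z) (quasi (phi z)) (theta z) (quasi (theta z)) a b c d.
Proof.
have [f0 wf0] := boundary_quasi p_lim0 (phi_0 z).
have [t0 wt0] := boundary_quasi p_lim0 (theta_0 z).
split => //.
- exact (solution_QD p_C1 p_gt0 (phi_sol z)).
- exact (solution_QD p_C1 p_gt0 (theta_sol z)).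
- exact: det_init.
Qed.

Lemma abcd_real : [/\ a^*%C = a, b^*%C = b, c^*%C = c & d^*%C = d].
Proof.
rewrite /a /b /c /d; case: alpha => [al|] /=; split;
  by apply: complex_ext => /=; ring.
Qed.

(** As p and q are real, the conjugate solves the equation for the conjugate parameter; its boundary
    values are again e1 and e2, and [fund_repr] does the rest. *)
Lemma solution_conj z u (e1 e2 : R[i]) : QD p q u (quasi u) (fun x => z * u x) ->
  clim (0^'+) u e1 -> clim (0^'+) (quasi u) e2 -> e1^*%C = e1 -> e2^*%C = e2 ->
  forall x, 0 < x -> (u x)^*%C =
    theta z^*%C x * (b * e1 - a * e2) - phi z^*%C x * (d * e1 - c * e2).
Proof.
move=> Q ue we r1 r2 x x0.
apply: (@fund_repr _ p q z^*%C _ _ _ _ _ _ _ _ (fund z^*%C) (fun x => (u x)^*%C)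
  (fun x => (quasi u x)^*%C) e1 e2 x _ _ _ x0).
- apply: QD_eq (QD_conj Q) => y _; exact: conjcM.
- by rewrite -[e1]r1; exact: clim_conj.
- by rewrite -[e2]r2; exact: clim_conj.
Qed.

Lemma phi_conj z x : 0 < x -> (phi z x)^*%C = phi z^*%C x.
Proof.
move=> x0; have [ra rb rc rd] := abcd_real; have F := fund z.
rewrite (solution_conj (fund_f F) (fund_f0 F) (fund_wf0 F) ra rb x0).
transitivity (phi z^*%C x * (b * c - a * d)); first by ring.
by rewrite (fund_det F) mulr1.
Qed.

Lemma theta_conj z x : 0 < x -> (theta z x)^*%C = theta z^*%C x.
Proof.
move=> x0; have [ra rb rc rd] := abcd_real; have F := fund z.
rewrite (solution_conj (fund_t F) (fund_t0 F) (fund_wt0 F) rc rd x0).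
transitivity (theta z^*%C x * (b * c - a * d)); first by ring.
by rewrite (fund_det F) mulr1.
Qed.

Lemma phi0_real x : 0 < x -> (phi 0 x)^*%C = phi 0 x.
Proof. by move=> x0; rewrite phi_conj // conjc0. Qed.

Lemma theta0_real x : 0 < x -> (theta 0 x)^*%C = theta 0 x.
Proof. by move=> x0; rewrite theta_conj // conjc0. Qed.

Lemma calRE z h x : L2 h -> 0 < x -> calR phi theta z h x = S z h x.
Proof.
by move=> h2 x0; rewrite /calR /green cint_split //; exact: L2M.
Qed.

Lemma cprim_conj u x : cL1 u -> cprim (fun y => (u y)^*%C) x = (cprim u x)^*%C.
Proof. by move=> u1; apply: cintegral_conj; [exact: measurable_itv|exact: cL1_itv]. Qed.

Lemma cint_conj u : cL1 u -> cint (fun y => (u y)^*%C) = (cint u)^*%C.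
Proof. exact: (cintegral_conj mRplus). Qed.

Lemma green0_conj h x : L2 h -> 0 < x -> (S 0 h x)^*%C = S 0 (fun y => (h y)^*%C) x.
Proof.
move=> h2 x0; rewrite /green conjc_green.
have f1 := L2M (phi_L2 0) h2; have t1 := L2M (theta_L2 0) h2.
rewrite -(cprim_conj x f1) -(cprim_conj x t1) -(cint_conj t1).
rewrite (theta0_real x0) (phi0_real x0).
have Ef y : 0 < y -> (phi 0 y * h y)^*%C = phi 0 y * (h y)^*%C.
  by move=> y0; rewrite conjcM phi0_real.
have Et y : 0 < y -> (theta 0 y * h y)^*%C = theta 0 y * (h y)^*%C.
  by move=> y0; rewrite conjcM theta0_real.
by rewrite (eq_cprim x Ef) (eq_cprim x Et) (eq_cint Et).
Qed.

Lemma Amin0_green h : L2 h -> pair (phi 0) h = 0 -> Amin p q alpha (S 0 h, h).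
Proof.
move=> h2 fh; have := Amin_green p_C1 q_C0 p_gt0 p_lim0 p0_gt0 (fund 0) h2 fh.
suff -> : (fun x => h x + 0 * S 0 h x) = h by [].
by apply/funext => x; rewrite mul0r addr0.
Qed.

Lemma Amin0_repr u k : Amin p q alpha (u, k) ->
  [/\ L2 u, L2 k, u = S 0 k %[ae mu in Rplus] & pair (phi 0) k = 0].
Proof.
move=> /(Amin_repr p_C1 q_C0 p_gt0 p_lim0 (fund 0)).
suff -> : (fun x => k x - 0 * u x) = k.
  suff -> : (fun x => phi 0 x * (k x - 0 * u x)) = fun x => phi 0 x * k x by [].
  by apply/funext => x; rewrite mul0r subr0.
by apply/funext => x; rewrite mul0r subr0.
Qed.

(* (u, k) is in A_max; A and B are its boundary values at infinity. *)
Definition Amax_bv u k (A B : R[i]) : Prop :=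
  [/\ L2 u, L2 k, u = (fun x => S 0 k x + A * phi 0 x) %[ae mu in Rplus] &
      pair (phi 0) k = B].

Lemma Amax_bv_lin u k u' k' A B A' B' e : Amax_bv u k A B -> Amax_bv u' k' A' B' ->
  Amax_bv (fun x => u x + e * u' x) (fun x => k x + e * k' x) (A + e * A') (B + e * B').
Proof.
move=> [u2 k2 E f] [u2' k2' E' f']; have ek := L2Z e k2'; split.
- by apply: L2D => //; exact: L2Z.
- exact: L2D.
- apply: ae_imp2 E E' => x H H' xR; rewrite (H xR) (H' xR).
  rewrite (green_D x (phi_L2 0) (theta_L2 0) k2 ek) (green_Z e x (phi_L2 0) (theta_L2 0) k2').
  by ring.
- rewrite -f -f' -cintZ; last exact: L2M.
  rewrite -cintD; [|exact: L2M|by apply: cL1Z; exact: L2M].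
  by apply: eq_cint => x _; ring.
Qed.

Lemma Amax_bv_ae u k u' k' A B : Amax_bv u k A B -> L2 u' -> L2 k' ->
  u = u' %[ae mu in Rplus] -> k = k' %[ae mu in Rplus] -> Amax_bv u' k' A B.
Proof.
move=> [u2 k2 E f] u2' k2' uu kk; split => //.
- apply: ae_imp2 E uu => x H H' xR.
  by rewrite -(H' xR) (H xR) (green_ae x (phi_L2 0) (theta_L2 0) k2 k2' kk).
- rewrite -f; apply: ae_eq_cint; [exact: L2M|exact: L2M|].
  by apply: ae_imp kk => x H xR; rewrite (H xR).
Qed.

(** Against v = S_0 g in D(A_min), symmetry of S_0 moves it onto g, and the phi_0 term disappears
    because (phi_0, g) = 0. *)
Lemma Amax_bv_Amax u k A B : Amax_bv u k A B -> Amax p q alpha (u, k).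
Proof.
move=> [u2 k2 E f]; split => //= v g /Amin0_repr[v2 g2 Ev fg].
have ck := L2_conj k2.
rewrite !innerE.
transitivity (cint (fun x => g x * S 0 (fun y => (k y)^*%C) x + A^*%C * (phi 0 x * g x))).
  apply: ae_eq_cint.
  - by apply: L2M => //; exact: L2_conj.
  - apply: cL1D; first by apply: L2M => //; exact: green_L2 (fund 0) _ ck.
    by apply: cL1Z; exact: L2M.
  apply: ae_imp E => x H xR; have Hx : u x = S 0 k x + A * phi 0 x := H xR.
  rewrite Hx (conjc_lin (S 0 k x) A (phi 0 x)).
  have x0 := Rplus_gt0 xR.
  by rewrite (green0_conj k2 x0) (phi0_real x0); ring.
rewrite cintD; [|by apply: L2M => //; exact: green_L2 (fund 0) _ ck|by apply: cL1Z; exact: L2M].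
rewrite cintZ ?fg ?mulr0 ?addr0; last exact: L2M.
rewrite -(green_sym (fund 0) g2 ck); apply: ae_eq_cint.
- by apply: L2M => //; exact: green_L2 (fund 0) _ g2.
- exact: L2M.
by apply: ae_imp Ev => x H xR; rewrite (H xR).
Qed.

(** Testing the adjoint relation on (S_0 g, g) shows that w = u - S_0 k is orthogonal to every g
    with (phi_0, g) = 0. The projection of w off phi_0 is such a g, so it is orthogonal to itself
    and vanishes. *)
Lemma Amax_bvP u k : Amax p q alpha (u, k) -> exists A, Amax_bv u k A (pair (phi 0) k).
Proof.
move=> [/= u2 k2 H]; have Sk := green_L2 (fund 0) k2.
have w2 := L2B u2 Sk.
pose w x := u x - S 0 k x.
have nz : pair (phi 0) (phi 0) != 0.
  have -> : pair (phi 0) (phi 0) = (sqnorm (phi 0))%:C.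
    by rewrite -cint_conj_self //; apply: eq_cint => x x0; rewrite phi0_real.
  by rewrite eq_complex /= negb_and (fund_sqnorm_neq0 p_gt0 (fund 0)).
pose l := pair (phi 0) w / pair (phi 0) (phi 0).
pose g x := w x - l * phi 0 x.
have lp2 := L2Z l (phi_L2 0).
have g2 : L2 g by exact: L2B.
have fg : pair (phi 0) g = 0.
  transitivity (pair (phi 0) w - l * pair (phi 0) (phi 0)).
    rewrite -cintZ; last exact: L2M.
    rewrite -cintB; [|exact: L2M|by apply: cL1Z; exact: L2M].
    by apply: eq_cint => x _; rewrite /g; ring.
  by rewrite /l divfK // subrr.
have ck := L2_conj k2; have cg := L2_conj g2; have cw := L2_conj w2.
have SG := green_L2 (fund 0) ck.
have gw0 : cint (fun x => g x * (w x)^*%C) = 0.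
  have := H _ _ (Amin0_green g2 fg); rewrite !innerE => E.
  transitivity (cint (fun x => g x * (u x)^*%C - g x * S 0 (fun y => (k y)^*%C) x)).
    by apply: eq_cint => x x0; rewrite /w conjcB green0_conj //; ring.
  rewrite cintB; [|apply: L2M => //; exact: L2_conj|exact: L2M].
  rewrite -(green_sym (fund 0) g2 ck).
  by apply/eqP; rewrite subr_eq0; apply/eqP.
have gg0 : cint (fun x => g x * (g x)^*%C) = 0.
  transitivity (cint (fun x => g x * (w x)^*%C - l^*%C * (phi 0 x * g x))).
    apply: eq_cint => x x0; rewrite {2}/g conjcB conjcM phi0_real //; ring.
  rewrite cintB; [|exact: L2M|by apply: cL1Z; exact: L2M].
  by rewrite cintZ ?gw0 ?fg ?mulr0 ?subr0 //; exact: L2M.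
have Ng : sqnorm g = 0.
  by have := gg0; rewrite cint_conj_self // => /(congr1 (@complex.Re R)).
exists l; split => //.
apply: ae_imp (sqnorm_eq0 g2 Ng) => x E xR; move: (E xR); rewrite /g /w => /eqP.
by rewrite subr_eq0 subr_eq => /eqP ->; ring.
Qed.

Lemma Amax_bv_unique_image u k A B k' A' B' : Amax_bv u k A B -> Amax_bv u k' A' B' ->
  k = k' %[ae mu in Rplus].
Proof.
move=> [u2 k2 E f] [_ k2' E' f'].
have : {ae mu, forall x, 0 < x -> k x - k' x = 0}.
  apply: (green_inj p_gt0 (fund 0) (e := A - A') (L2B k2 k2')).
  apply: ae_imp2 E E' => x H H' x0; have xR : Rplus x by rewrite RplusE.
  rewrite (green_B x (phi_L2 0) (theta_L2 0) k2 k2').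
  have := H xR; rewrite (H' xR) => E.
  transitivity ((S 0 k x + A * phi 0 x) - (S 0 k' x + A' * phi 0 x)); first by ring.
  by rewrite E subrr.
by apply: ae_imp => x H /Rplus_gt0 /H /eqP; rewrite subr_eq0 => /eqP.
Qed.

(** Two parameters because both cases are used: y = 0 gives boundary values, y = z gives a preimage
    of omega theta_z under S_z. Compared with Green's formula for theta_z itself, only the boundary
    terms at 0 differ: they are b c - a d = 1 against phi_y, and 0 against theta_y. *)
Lemma cutoff_theta (z y : R[i]) : let u : R -> R[i] := fun x => (omega x)%:C * theta z x in
  let k : R -> R[i] := fun x => calA p q u x - y * u x in
  [/\ L2 u, L2 (calA p q u),
      pair (phi y) k = 1 + (z - y) * pair (phi y) (theta z) &
      forall x, 0 < x -> S y k x = u x + ((z - y) * pair (theta y) (theta z)) * phi y x].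
Proof.
move=> u k.
have [om2 [dl /= dl0 om0] [X [_ om1]]] := omega_cutoff.
have {}om0 x : 0 < x -> x < dl -> omega x = 0.
  by move=> x0 xd; apply: om0 => //=; rewrite sub0r normrN gtr0_norm.
have F := fund z.
have u2 : cCn 2 u by apply: cCn2_real_mul; [exact: om2|have [] := theta_sol z].
have Q : QD p q u (quasi u) (calA p q u) := cCn2_QD q p_C1 p_gt0 u2.
have nearX x : X < x -> \forall y \near x, u y = theta z y.
  move=> Xx; have : \forall y \near x, X < y by exact: lt_nbhsr.
  by apply: filterS => y' /om1 E; rewrite /u E mul1r.
have near0 x : 0 < x -> x < dl -> \forall y \near x, u y = 0.
  move=> x0 xd; have n1 : \forall y \near x, 0 < y by exact: lt_nbhsr.
  have n2 : \forall y \near x, y < dl by exact: lt_nbhsl.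
  by apply: filterS2 n1 n2 => y' y1 y2; rewrite /u om0 // mul0r.
have uX x : X < x -> u x = theta z x by move=> /nearX /nbhs_singleton.
have u0 x : 0 < x -> x < dl -> u x = 0 by move=> x0 xd; exact: nbhs_singleton (near0 x x0 xd).
have wX x : X < x -> quasi u x = quasi (theta z) x.
  by move=> /nearX /cderiv_near E; rewrite /quasi E.
have d0 x : cderiv (fun=> 0 : R[i]) x = 0 by apply: cder_cderiv; exact: cder_cst.
have w0 x : 0 < x -> x < dl -> quasi u x = 0.
  by move=> x0 xd; rewrite /quasi (cderiv_near (near0 x x0 xd)) d0 mulr0.
have AX x : 0 < x -> X < x -> calA p q u x = z * theta z x.
  by move=> x0 /nearX /(calA_near p q) ->; have [_ ->] := theta_sol z.
have A0 x : 0 < x -> x < dl -> calA p q u x = 0.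
  move=> x0 xd; rewrite (calA_near p q (near0 x x0 xd)) /calA mulr0 addr0.
  rewrite (_ : (fun y' => _) = fun=> 0) ?d0 ?oppr0 //.
  by apply/funext => y'; rewrite d0 mulr0.
have nr : \forall x \near (0:R)^'+, 0 < x /\ x < dl.
  near=> x; split; first by near: x; exact: nbhs_right_gt.
  by near: x; exact: nbhs_right_lt.
have lu : clim (0^'+) u 0.
  by apply: clim_near (clim_cst 0); apply: filterS nr => x [x0 xd]; rewrite u0.
have lw : clim (0^'+) (quasi u) 0.
  by apply: clim_near (clim_cst 0); apply: filterS nr => x [x0 xd]; rewrite w0.
have cu x : 0 < x -> ccont u x by move=> x0; have [] := QD_ccont Q x0.
have cA (x : R) (x0 : 0 < x) : ccont (calA p q u) x := calA_ccont p_C1 q_C0 u2 x0.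
have ck y' x : 0 < x -> ccont (fun x => calA p q u x - y' * u x) x.
  move=> x0; apply: climB; first exact: cA.
  by apply: climM; [exact: clim_cst|exact: cu].
pose Y := Num.max X 0 + 1.
have XY : X < Y by rewrite /Y; have := @le_max _ _ X X 0; rewrite lexx /= => h; lra.
have Y0 : 0 < Y by rewrite /Y; have := @le_max _ _ 0 X 0; rewrite lexx orbT => h; lra.
(* the boundary terms of Green's formula at Y are those of theta z *)
have key y' : L2 (fun x => calA p q u x - y' * u x) ->
  [/\ pair (phi y') (fun x => calA p q u x - y' * u x) = 1 + (z - y') * pair (phi y') (theta z),
      pair (theta y') (fun x => calA p q u x - y' * u x) = (z - y') * pair (theta y') (theta z) &
      forall x, 0 < x -> S y' (fun x => calA p q u x - y' * u x) x =
        u x + ((z - y') * pair (theta y') (theta z)) * phi y' x].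
  move=> k2; have F' := fund y'.
  have form (x : R) (x0 : 0 < x) := green_formula F' Q (fun _ _ => erefl) (ck y') k2 lu lw x0.
  have m2 : L2 (fun x => (z - y') * theta z x) by exact: L2Z.
  have cm x : 0 < x -> ccont (fun x => (z - y') * theta z x) x.
    move=> x0; apply: climM; first exact: clim_cst.
    by have [] := QD_ccont (fund_t F) x0.
  have mE x : 0 < x -> (z - y') * theta z x = z * theta z x - y' * theta z x.
    by move=> _; rewrite mulrBl.
  have [G1 G2 _] := green_formula F' (fund_t F) mE cm m2 (fund_t0 F) (fund_wt0 F) Y0.
  have [E1 E2 _] := form Y Y0.
  (* Beyond Y the cut-off is 1, so (A - y') u has the tail of (z - y') theta_z. *)
  have tail v : L2 v -> pair v (fun x => calA p q u x - y' * u x) =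
    (z - y') * pair v (theta z) + (cprim (fun x => v x * (calA p q u x - y' * u x)) Y -
       cprim (fun x => v x * ((z - y') * theta z x)) Y).
    move=> v2; have := @cint_tail _ _ _ Y Y0 (L2M v2 k2) (L2M v2 m2).
    have -> : cint (fun x => v x * ((z - y') * theta z x)) = (z - y') * pair v (theta z).
      rewrite -cintZ; last exact: L2M.
      by apply: eq_cint => x _; ring.
    move=> /(_ _)/eqP; rewrite subr_eq => H; apply/eqP; move: H => /(_ _) /eqP -> //; first by apply/eqP; ring.
    by move=> x Yx; have Xx := lt_trans XY Yx; rewrite uX // AX ?mE //; exact: lt_trans Yx.
  have T1 : pair (phi y') (fun x => calA p q u x - y' * u x) = 1 + (z - y') * pair (phi y') (theta z).
    rewrite tail // E1 G1 uX // wX // -(fund_det F'); ring.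
  have T2 : pair (theta y') (fun x => calA p q u x - y' * u x) = (z - y') * pair (theta y') (theta z).
    rewrite tail // E2 G2 uX // wX //; ring.
  split => // x x0; have [_ _ ->] := form x x0; rewrite T2; ring.
(* The case y' = z comes first: (A - z) u vanishes near 0 and for large x, so it is in L^2; then u,
   its image under S_z, is in L^2, and so is A u. Only then is [key] available for y. *)
have e2 : L2 (fun x => calA p q u x - z * u x).
  apply: (L2_bounded_supp (ck z) (l := 0)).
  - by apply: clim_near (clim_cst 0); apply: filterS nr => x [x0 xd]; rewrite A0 // u0 // mulr0 subrr.
  - exists Y; split; rewrite ?num_real // => x Yx; have Xx := lt_trans XY Yx.
    by rewrite uX // AX ?subrr //; exact: lt_trans Yx.
have [_ _ Se] := key z e2.
have Lu : L2 u.
  apply: L2_eq (green_L2 F e2) => x x0; rewrite Se // subrr !mul0r addr0 //.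
have LA : L2 (calA p q u).
  by apply: L2_eq (L2D e2 (L2Z z Lu)) => x _; rewrite subrK.
have [K1 K2 K3] := key y (L2B LA (L2Z y Lu)).
by split.
Unshelve. all: by end_near. Qed.

(** Green's formula at parameter 0 with right-hand side z phi_z; the initial values contribute d a -
    c b = -1 to the coefficient of phi_0. *)
Lemma Amax_bv_phi z : Amax_bv (phi z) (fun x => z * phi z x)
  (1 - z * pair (theta 0) (phi z)) (z * pair (phi 0) (phi z)).
Proof.
have F := fund z; have k2 := L2Z z (phi_L2 z).
have ck x : 0 < x -> ccont (fun x => z * phi z x) x.
  by move=> x0; apply: climM; [exact: clim_cst|have [] := QD_ccont (fund_f F) x0].
have kE x : 0 < x -> z * phi z x = z * phi z x - 0 * phi z x.
  by move=> _; rewrite mul0r subr0.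
have mv v : L2 v -> pair v (fun x => z * phi z x) = z * pair v (phi z).
  move=> v2; rewrite -cintZ; last exact: L2M.
  by apply: eq_cint => x _; ring.
split => //; last exact: mv.
apply: ae_Rplus => x x0.
have [_ _ ->] := green_formula (fund 0) (fund_f F) kE ck k2 (fund_f0 F) (fund_wf0 F) x0.
rewrite mv // -(fund_det F); ring.
Qed.

Lemma Amax_bv_cutoff z : let u : R -> R[i] := fun x => (omega x)%:C * theta z x in
  Amax_bv u (calA p q u) (- (z * pair (theta 0) (theta z))) (1 + z * pair (phi 0) (theta z)).
Proof.
move=> u; have [u2 A2 E1 E2] := cutoff_theta z 0.
have kE x : 0 < x -> calA p q u x = calA p q u x - 0 * u x.
  by move=> _; rewrite mul0r subr0.
split => //.
- apply: ae_Rplus => x x0; have E2x := E2 x x0.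
  by rewrite (green_eq _ _ _ kE) E2x subr0 mulNr addrK.
- transitivity (pair (phi 0) (fun x => calA p q u x - 0 * u x)).
    by apply: eq_cint => x x0; rewrite -kE.
  by rewrite E1 subr0.
Qed.

Lemma Amax_bv_green z h : L2 h -> Amax_bv (S z h) (fun x => h x + z * S z h x)
  (- (z * pair (theta 0) (theta z)) * pair (phi z) h)
  ((1 + z * pair (phi 0) (theta z)) * pair (phi z) h).
Proof.
move=> h2; have F := fund z.
pose u x := (omega x)%:C * theta z x.
pose eta x := calA p q u x - z * u x.
pose e := pair (phi z) h.
have [u2 A2 E1 E2] := cutoff_theta z z.
have eta2 : L2 eta by apply: L2B => //; exact: L2Z.
have Eeta : pair (phi z) eta = 1 by rewrite E1 subrr mul0r addr0.
have Seta x : 0 < x -> S z eta x = u x by move=> x0; rewrite E2 // subrr !mul0r addr0.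
pose h1 x := h x - e * eta x.
have ee2 := L2Z e eta2.
have h12 : L2 h1 by exact: L2B.
have fh1 : pair (phi z) h1 = 0.
  transitivity (pair (phi z) h - e * pair (phi z) eta); last by rewrite Eeta mulr1 subrr.
  rewrite -cintZ; last exact: L2M.
  rewrite -cintB; [|exact: L2M|by apply: cL1Z; exact: L2M].
  by apply: eq_cint => x _; rewrite /h1; ring.
have [S1 K1 E f] := Amin0_repr (Amin_green p_C1 q_C0 p_gt0 p_lim0 p0_gt0 F h12 fh1).
(* S_z h1 is in D(A_min), so the boundary values of S_z h are e times those of omega theta_z. *)
have G1 : Amax_bv (S z h1) (fun x => h1 x + z * S z h1 x) 0 0.
  by split => //; apply: ae_imp E => x H xR; rewrite (H xR) mul0r addr0.
have SE x : 0 < x -> S z h1 x = S z h x - e * u x.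
  move=> x0; rewrite (green_B x (phi_L2 z) (theta_L2 z) h2 ee2).
  by rewrite (green_Z e x (phi_L2 z) (theta_L2 z) eta2) Seta.
have := Amax_bv_lin e G1 (Amax_bv_cutoff z); rewrite !add0r ![e * _]mulrC.
have Sh := green_L2 F h2.
move=> G; apply: (Amax_bv_ae G Sh (L2D h2 (L2Z z Sh))).
- by apply: ae_Rplus => x x0; rewrite (SE x x0) -/(u x) subrK.
- apply: ae_Rplus => x x0; rewrite (SE x x0) /h1 /eta -/u.
  move: (calA p q u x) => w; ring.
Qed.

Definition bdry (t : option R) (A B : R[i]) : Prop :=
  if t is Some s then A = s%:C * B else B = 0.

(** D(A_min) has boundary values (0, 0), phi_0 has (1, 0) and omega theta_0 has (0, 1); the spanning
    function therefore has (s, 1) or, for t = oo, (1, 0). The k found here is identified later, by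
    single-valuedness of A_max. *)
Lemma dom_At_repr t u : domAt omega phi theta p q alpha t u -> L2 u ->
  exists k A B, Amax_bv u k A B /\ bdry t A B.
Proof.
move=> [v [g /Amin0_repr[v2 g2 Ev fg]] [e Eu]] u2.
have Gg : Amax_bv v g 0 0.
  by split => //; apply: ae_imp Ev => x H xR; rewrite (H xR) mul0r addr0.
have G0 : Amax_bv (phi 0) (fun x => 0 * phi 0 x) 1 0.
  by have := Amax_bv_phi 0; rewrite !mul0r subr0.
have Gt := Amax_bv_cutoff 0; rewrite !mul0r oppr0 addr0 in Gt.
case: t Eu => [s|] Eu.
- have := Amax_bv_lin e Gg (Amax_bv_lin s%:C Gt G0) => G.
  have Gu := Amax_bv_ae G u2 _ _ (ae_eq_refl _ _ _).
  do 3 eexists; split.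
    apply: Gu; first by have [_ k2 _ _] := G.
    apply: ae_imp Eu => x H xR; rewrite (H xR) /extra_fun; ring.
  by rewrite /bdry; ring.
- have := Amax_bv_lin e Gg G0 => G.
  have Gu := Amax_bv_ae G u2 _ _ (ae_eq_refl _ _ _).
  do 3 eexists; split.
    apply: Gu; first by have [_ k2 _ _] := G.
    by apply: ae_imp Eu => x H xR; rewrite (H xR).
  by rewrite /bdry; ring.
Qed.

Lemma At_bv t u k : At omega phi theta p q alpha t (u, k) <->
  exists A B, Amax_bv u k A B /\ bdry t A B.
Proof.
split.
- move=> [/= /Amax_bvP[A G] /dom_At_repr D].
  have [u2 k2 _ _] := G.
  have [k' [A' [B' [G' bd]]]] := D u2.
  have kk := Amax_bv_unique_image G' G.
  exists A', B'; split => //; exact: Amax_bv_ae G' u2 k2 (ae_eq_refl _ _ _) kk.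
- move=> [A [B [G bd]]]; split => /=; first exact: Amax_bv_Amax G.
  have [u2 k2 E f] := G.
  have Gt := Amax_bv_cutoff 0; rewrite !mul0r oppr0 addr0 in Gt.
  have [ut2 At2 Et ft] := Gt.
  case: t bd => [s|] /= bd.
  (* Subtracting B omega theta_0 cancels the second boundary value; the rest is S_0 k1 in D(A_min)
     plus A phi_0, and A = s B makes it B times the spanning function. *)
  + pose k1 x := k x + (- B) * calA p q (fun x => (omega x)%:C * theta 0 x) x.
    have mB2 := L2Z (- B) At2.
    have k12 : L2 k1 by exact: L2D.
    have fk1 : pair (phi 0) k1 = 0.
      have [_ _ _] := Amax_bv_lin (- B) G Gt.
      by rewrite mulr1 subrr.
    exists (S 0 k1); first by exists k1; exact: Amin0_green.
    exists B; apply: ae_imp2 E Et => x H H' xR; rewrite (H xR) /extra_fun.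
    rewrite (H' xR) mul0r addr0 (green_D x (phi_L2 0) (theta_L2 0) k2 mB2).
    by rewrite (green_Z (- B) x (phi_L2 0) (theta_L2 0) At2) bd; ring.
  + rewrite bd in f.
    by exists (S 0 k); [exists k; exact: Amin0_green|exists A; exact: E].
Qed.

Lemma Amax_bv_self t z u A B : complex.Im z != 0 -> Amax_bv u (fun x => z * u x) A B ->
  bdry t A B -> sqnorm u = 0.
Proof.
move=> z0 [u2 k2 E f] bd.
pose k x := z * u x.
have ck := L2_conj k2; have cu := L2_conj u2.
have Sk := green_L2 (fund 0) k2; have Sc := green_L2 (fund 0) ck.
have e1 : cint (fun x => k x * (u x)^*%C) = z * (sqnorm u)%:C.
  rewrite -cint_conj_self // -cintZ; last exact: L2M.
  by apply: eq_cint => x _; rewrite /k mulrA.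
have e2 : cint (fun x => u x * (k x)^*%C) = z^*%C * (sqnorm u)%:C.
  rewrite -cint_conj_self // -cintZ; last exact: L2M.
  by apply: eq_cint => x _; rewrite /k conjcM mulrCA.
have f1 := L2M (phi_L2 0) k2; have f1c := L2M (phi_L2 0) ck.
have e3 : cint (fun x => k x * (u x)^*%C) =
    cint (fun x => k x * S 0 (fun y => (k y)^*%C) x) + A^*%C * B.
  rewrite -f -cintZ // -cintD; [|exact: L2M|exact: cL1Z].
  apply: ae_eq_cint; [exact: L2M|apply: cL1D; [exact: L2M|exact: cL1Z]|].
  apply: ae_imp E => x H xR; have Hx : u x = S 0 k x + A * phi 0 x := H xR.
  rewrite {1}Hx (conjc_lin (S 0 k x) A (phi 0 x)).
  rewrite (green0_conj k2 (Rplus_gt0 xR)) (phi0_real (Rplus_gt0 xR)) -/(k x); ring.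
have e4 : cint (fun x => u x * (k x)^*%C) =
    cint (fun x => S 0 k x * (k x)^*%C) + A * B^*%C.
  have -> : B^*%C = cint (fun x => phi 0 x * (k x)^*%C).
    rewrite -f -cint_conj //; apply: eq_cint => x x0.
    by rewrite conjcM (phi0_real x0).
  rewrite -(cintZ A f1c) -(cintD (L2M Sk ck) (cL1Z A f1c)).
  apply: (ae_eq_cint (L2M u2 ck) (cL1D (L2M Sk ck) (cL1Z A f1c))).
  apply: ae_imp E => x H xR; have Hx : u x = S 0 k x + A * phi 0 x := H xR.
  by rewrite Hx; ring.
(* Symmetry of S_0 cancels the two integral terms, leaving only the boundary form, which is zero
   under [bdry] because s is real. *)
have : (z - z^*%C) * (sqnorm u)%:C = A^*%C * B - A * B^*%C.
  rewrite mulrBl -e1 -e2 e3 e4 (green_sym (fund 0) k2 ck); ring.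
have -> : A^*%C * B - A * B^*%C = 0.
  case: t bd => [s|] /= ->; last by rewrite conjc0 !mulr0 subrr.
  by rewrite conjcM conjc_real; ring.
move=> /eqP; rewrite mulf_eq0 => /orP[|/eqP /(congr1 (@complex.Re R))//].
rewrite subr_eq0 => /eqP /(congr1 (@complex.Im R)) /=; rewrite cImC => zz.
by move: z0; rewrite (_ : complex.Im z = 0) ?eqxx //; lra.
Qed.

Lemma inner_theta0 u : inner u (theta 0) = pair (theta 0) u.
Proof. by rewrite innerE; apply: eq_cint => x x0; rewrite theta0_real // mulrC. Qed.

Lemma inner_phi0 u : inner u (phi 0) = pair (phi 0) u.
Proof. by rewrite innerE; apply: eq_cint => x x0; rewrite phi0_real // mulrC. Qed.

Lemma gamma_den_neq0 t z : complex.Im z != 0 -> gamma_den phi theta t z != 0.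
Proof.
move=> z0; apply/eqP => den0.
have := fund_sqnorm_neq0 p_gt0 (fund z).
rewrite (Amax_bv_self (t := t) z0 (Amax_bv_phi z)) ?eqxx //.
(* For phi_z the denominator is A - s B when t is finite and B when t = oo, so its vanishing is the
   condition [bdry]. *)
move: den0; rewrite /gamma_den inner_theta0 inner_phi0 /bdry.
by case: t => [s|] // H; apply/eqP; rewrite -subr_eq0 -[X in _ == X]H; apply/eqP; ring.
Qed.

(** The condition [bdry] is one linear equation for the coefficient of phi_z; its leading
    coefficient is, up to sign, the denominator of gamma. *)
Lemma Amax_bv_resolvent t z h : complex.Im z != 0 -> L2 h ->
  exists A B, Amax_bv (fun x => S z h x + (gamma phi theta t z * pair (phi z) h) * phi z x)
    (fun x => (h x + z * S z h x) + (gamma phi theta t z * pair (phi z) h) * (z * phi z x)) A B /\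
    bdry t A B.
Proof.
move=> z0 h2; do 2 eexists; split; first exact: Amax_bv_lin (Amax_bv_green z h2) (Amax_bv_phi z).
have := gamma_den_neq0 t z0; rewrite /bdry /gamma.
case: t => [s|]; rewrite /gamma_den ?inner_theta0 ?inner_phi0.
- move: (pair (theta 0) (theta z)) (pair (phi 0) (theta z)) (pair (theta 0) (phi z))
    (pair (phi 0) (phi z)) (pair (phi z) h) => m1 m2 m3 m4 m5 nz; field; exact: nz.
- move: (pair (theta 0) (theta z)) (pair (phi 0) (theta z)) (pair (theta 0) (phi z))
    (pair (phi 0) (phi z)) (pair (phi z) h) => m1 m2 m3 m4 m5 nz; field.
  by move: nz; rewrite mulf_eq0 negb_or => /andP[-> ->].
Qed.

Lemma resolvent_formula t z : complex.Im z != 0 ->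
  gamma_den phi theta t z != 0 /\
  forall h, L2 h -> forall u,
    resolvent (At omega phi theta p q alpha t) z (h, u) <->
    L2 u /\
    u = (fun x => gamma phi theta t z * inner h (phi z^*) * phi z x
                  + calR phi theta z h x) %[ae mu in Rplus].
Proof.
move=> z0; split; first exact: gamma_den_neq0.
move=> h h2 u.
have EI : inner h (phi z^*%C) = pair (phi z) h.
  by rewrite innerE; apply: eq_cint => x x0; rewrite phi_conj // conjcK mulrC.
pose U x := S z h x + (gamma phi theta t z * pair (phi z) h) * phi z x.
have UE x : 0 < x -> gamma phi theta t z * inner h (phi z^*%C) * phi z x
   + calR phi theta z h x = U x.
  by move=> x0; rewrite calRE // EI addrC.
have [A [B [G bd]]] := Amax_bv_resolvent t z0 h2.
have [U2 K2 _ _] := G.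
have hzu v : L2 v -> L2 (fun x => h x + z * v x) by move=> v2; apply: L2D => //; exact: L2Z.
apply: (iff_trans (resolventP _ _ _ _)); apply: (iff_trans (At_bv _ _ _)); split.
- move=> [A' [B' [G' bd']]]; have [u2 _ _ _] := G'; split => //.
  (* Uniqueness: in u - U the terms in h cancel, so the difference satisfies A_t v = z v and must
     vanish. *)
  have D := Amax_bv_lin (-1) G' G.
  have uU2 : L2 (fun x => u x + (-1) * U x) by apply: L2D => //; exact: L2Z.
  have D' : Amax_bv (fun x => u x + (-1) * U x) (fun x => z * (u x + (-1) * U x))
      (A' + (-1) * A) (B' + (-1) * B).
    apply: (Amax_bv_ae D uU2 (L2Z z uU2)); first by apply: ae_Rplus.
    by apply: ae_Rplus => x _; rewrite /U; ring.
  have bdD : bdry t (A' + (-1) * A) (B' + (-1) * B).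
    case: t bd bd' {UE U G U2 K2 D uU2 D'} => [s|] /= -> ->; ring.
  apply: ae_imp (sqnorm_eq0 uU2 (Amax_bv_self z0 D' bdD)) => x H xR.
  have x0 := Rplus_gt0 xR; have := H xR; rewrite mulN1r => /eqP.
  by rewrite subr_eq0 => /eqP ->; rewrite -UE.
- move=> [u2 E]; exists A, B; split => //.
  have uU : u = U %[ae mu in Rplus].
    by apply: ae_imp E => x H xR; rewrite (H xR) UE //; exact: Rplus_gt0.
  apply: (Amax_bv_ae G u2 (hzu u u2)); first exact: ae_eq_sym.
  by apply: ae_imp uU => x H xR; rewrite (H xR) /U; ring.
Qed.

End Main.

Unset Implicit Arguments.

Theorem theorem3p7 (R : realType)
  (p q : R -> R) (p0 q0 : R)
  (p_C1 : Cn 1 p) (q_C0 : Cn 0 q)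
  (p_lim0 : p x @[x --> 0^'+] --> p0) (q_lim0 : q x @[x --> 0^'+] --> q0)
  (p_gt0 : forall x, 0 < x -> 0 < p x) (p0_gt0 : 0 < p0)
  (alpha : option R)
  (omega : R -> R) (omega_cutoff : cutoff omega)
  (phi theta : R[i] -> R -> R[i])
  (phi_sol : forall z, solution p q z (phi z))
  (phi_0 : forall z, boundary_values (phi z) (phi_init alpha))
  (theta_sol : forall z, solution p q z (theta z))
  (theta_0 : forall z, boundary_values (theta z) (theta_init p0 alpha))
  (phi_L2 : forall z, L2 (phi z)) (theta_L2 : forall z, L2 (theta z))
  (t : option R) (z : R[i]) (z_nonreal : complex.Im z != 0) :
  gamma_den phi theta t z != 0 /\
  forall h : R -> R[i], L2 h -> forall u : R -> R[i],
    resolvent (At omega phi theta p q alpha t) z (h, u) <->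
    L2 u /\
    u = (fun x => gamma phi theta t z * inner h (phi z^*) * phi z x
                  + calR phi theta z h x)
      %[ae @lebesgue_measure R in Rplus].
Proof.
exact (resolvent_formula p_C1 q_C0 p_lim0 p_gt0 p0_gt0 omega_cutoff
  phi_sol phi_0 theta_sol theta_0 phi_L2 theta_L2 t z_nonreal).
Qed.
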